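(* Consider infinite, connected, simple, quasi-transitive graphs $G=(V,E)$ with bounded maximum degree, with initial water levels $\{\eta_0(u)\}_{u\in V}$ that are i.i.d. uniformly distributed on $[0,1]$, and for $v\in V$ let $\kappa_G(v)$ denote the supremum of water levels achievable at $v$ by finite move sequences, starting from the initial profile. Then the only such graph $G$ for which $\kappa_G(v)$ is not deterministic is (up to isomorphism) the two-sided infinite path $\mathbb{Z}$. That is, for every such $G$ and every $v\in V$, $\kappa_G(v)$ fails to be almost surely constant if and only if $G$ is isomorphic to the graph with vertex set $\mathbb{Z}$ and edge set $\{\langle u,u+1\rangle: u\in\mathbb{Z}\}$.
   Context: All graphs are undirected; simple means having neither loops nor multiple edges; $\langle x,y\rangle$ denotes the edge between $x$ and $y$; $\mathbb{N}_0=\{0,1,2,\dots\}$. Water transport. Given an initial water profile $\{\eta_0(u)\}_{u\in V}\in[0,1]^V$, a move is a pair $(e,\mu)\in E\times(0,\tfrac12]$. A finite sequence of moves $(e_1,\mu_1),\dots,(e_T,\mu_T)$, $T\in\mathbb{N}_0$, produces profiles $\eta_1,\dots,\eta_T$ recursively: if $e_k=\langle x,y\rangle$, $\eta_{k-1}(x)=a$ and $\eta_{k-1}(y)=b$, then $$\eta_k(x)=a+\mu_k(b-a),\qquad \eta_k(y)=b+\mu_k(a-b),$$ and $\eta_k(w)=\eta_{k-1}(w)$ for all $w\in V\setminus\{x,y\}$. For $v\in V$, $$\kappa_G(v):=\sup\{r\ge 0:\ \text{there exist } T\in\mathbb{N}_0 \text{ and a move sequence of length } T \text{ such that } \eta_T(v)=r\}.$$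 The move sequence may be chosen depending on the initial profile. When the initial profile is random, $\kappa_G(v)$ is a random variable; it is called deterministic if it is almost surely constant. Quasi-transitivity. A graph automorphism of $G$ is a bijection $f:V\to V$ such that $\langle f(u),f(w)\rangle\in E$ if and only if $\langle u,w\rangle\in E$. $G$ is quasi-transitive if $V$ can be partitioned into finitely many classes such that for any two vertices $u,w$ in the same class there is a graph automorphism $f$ with $f(u)=w$. *)

(* Defs.v *)
From HB Require Import structures.
From mathcomp Require Import all_boot all_order all_algebra.
From mathcomp Require Import finmap.
From mathcomp Require Import all_classical all_reals all_analysis.

Set Implicit Arguments.
Unset Strict Implicit.
Unset Printing Implicit Defensive.

Import Order.TTheory GRing.Theory Num.Theory.

Local Open Scope classical_set_scope.
Local Open Scope ring_scope.

Record sgraph := SGraph {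
  vertex :> choiceType;
  adj : rel vertex;
  adj_sym : symmetric adj;
  adj_irrefl : irreflexive adj }.

Arguments adj {s}.

Definition connected_graph (G : sgraph) : Prop :=
  forall u w : G, exists2 p : seq G, path adj u p & last u p = w.

Definition bounded_degree (G : sgraph) : Prop :=
  exists D : nat, forall u : G, ([set w | adj u w] #<= `I_D)%card.

Definition graph_isom (G H : sgraph) (f : G -> H) : Prop :=
  bijective f /\ forall u w : G, adj (f u) (f w) = adj u w.

Definition isomorphic (G H : sgraph) : Prop :=
  exists f : G -> H, graph_isom f.

Definition automorphism (G : sgraph) (f : G -> G) : Prop := graph_isom f.

(* The classes of the partition are the fibres of c (some may be empty). *)
Definition quasi_transitive (G : sgraph) : Prop :=
  exists (k : nat) (c : G -> 'I_k), forall u w : G,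
    c u = c w -> exists2 f : G -> G, automorphism f & f u = w.

Definition int_adj : rel int := fun u w => (w == u + 1) || (u == w + 1).

Lemma int_adj_sym : symmetric int_adj.
Proof. by move=> u w; rewrite /int_adj orbC. Qed.

Lemma int_adj_irrefl : irreflexive int_adj.
Proof. by move=> u; rewrite /int_adj orbb -[X in X == _]addr0 (inj_eq (addrI u)). Qed.

Definition int_path : sgraph := SGraph int_adj_sym int_adj_irrefl.

Section WaterTransport.
Variables (R : realType) (G : sgraph).

(* A move carries its edge as an ordered pair of endpoints; the resulting
   profile does not depend on the orientation. *)
Record move := Move { src : G; tgt : G; frac : R }.

Definition legal_move (m : move) : bool :=
  [&& adj (src m) (tgt m), 0 < frac m & frac m <= 2^-1].

Definition do_move (eta : G -> R) (m : move) : G -> R :=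
  let: Move x y mu := m in
  fun w => if w == x then eta x + mu * (eta y - eta x)
           else if w == y then eta y + mu * (eta x - eta y)
           else eta w.

Definition do_moves (eta : G -> R) (s : seq move) : G -> R :=
  foldl do_move eta s.

Definition achievable (eta : G -> R) (v : G) : set R :=
  [set r | 0 <= r /\ exists2 s : seq move, all legal_move s & do_moves eta s v = r].

(* For profiles with values in [0, 1] the set is nonempty and bounded by 1, so
   that sup is the genuine supremum. *)
Definition kappa (eta : G -> R) (v : G) : R := sup (achievable eta v).

End WaterTransport.

Section Probability.
Context {R : realType} {d : measure_display} {T : measurableType d}.
Variable P : probability T R.

Definition mutually_independent (I : choiceType) (X : I -> {RV P >-> R}) : Prop :=
  forall (J : {fset I}) (A : I -> set R),
    (forall i, i \in J -> measurable (A i)) ->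
    P (\bigcap_(i in [set` J]) (X i @^-1` A i)) =
      (\prod_(i <- J) P (X i @^-1` A i))%E.

Definition uniform01 (X : {RV P >-> R}) : Prop :=
  forall A : set R, measurable A ->
    distribution P X A = uniform_prob (@ltr01 R) A.

Definition iid_uniform01 (I : choiceType) (X : I -> {RV P >-> R}) : Prop :=
  mutually_independent X /\ forall i, uniform01 (X i).

(* {ae P, _} refers to sets included in a measurable null set, so X need not be
   known to be measurable. *)
Definition deterministic (X : T -> R) : Prop :=
  exists c : R, {ae P, forall w, X w = c}.

End Probability.

(* Main.v *)
(** On the line, the level at a vertex is a convex combination of the initial
levels whose weights are unimodal along the line, and a weight at distance m
from the vertex is at most 1 / (m + 1).  If all partial sums of the initial
levels, on either side, lie between 2n/5 and 3n/5, then every interval containing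
the mode m has sum at most 3/5 of its length plus |m|/5, so the level stays
below 3/5 + 1/5.  This event has positive probability (prescribe the levels near
the vertex, use Chernoff's bound further out), whereas the initial level alone
exceeds 9/10 with positive probability.

Any other graph has a vertex whose degree is not 2, hence, by
quasi-transitivity, a geodesic ray from v with a neighbour outside of the ray at
positive density.  A neighbour filled to at least h and attached at distance n can be
averaged with the first n + 1 vertices of the ray, which multiplies the gap to
h at v by 1 - 1/(n + 2).  Working from far to near, the expected product of these
factors is at most a product of terms 1 - c/j and tends to 0, so the level 1 is
approached almost surely. *)

Require Import Defs.
From mathcomp Require Import all_boot all_order all_algebra finmap ring lra zify.
From mathcomp Require Import all_classical all_reals all_analysis.

Set Implicit Arguments.
Unset Strict Implicit.
Unset Printing Implicit Defensive.

Import Order.TTheory GRing.Theory Num.Theory.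

Local Open Scope classical_set_scope.
Local Open Scope ring_scope.

(** * Unimodal weights on a path *)

(** Indexing by cells lets the same operation act on levels along a path and, dually, on the weights
    of a level. *)
Definition exchange (R : realType) (a : nat -> R) (k : nat) (mu : R) : nat -> R :=
  fun j => if j == k then a k + mu * (a k.+1 - a k)
           else if j == k.+1 then a k.+1 + mu * (a k - a k.+1) else a j.

Lemma exchangeE1 (R : realType) (a : nat -> R) k mu :
  exchange a k mu k = a k + mu * (a k.+1 - a k).
Proof. by rewrite /exchange eqxx. Qed.

Lemma exchangeE2 (R : realType) (a : nat -> R) k mu :
  exchange a k mu k.+1 = a k.+1 + mu * (a k - a k.+1).
Proof. by rewrite /exchange eqxx gtn_eqF. Qed.

Lemma exchange_out (R : realType) (a : nat -> R) k mu j :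
  j <> k -> j <> k.+1 -> exchange a k mu j = a j.
Proof. by rewrite /exchange => /eqP/negbTE -> /eqP/negbTE ->. Qed.

Lemma sum_update2 (R : realType) (F F' : nat -> R) n k : (k.+1 < n)%N ->
  (forall j, j <> k -> j <> k.+1 -> F' j = F j) ->
  \sum_(j < n) F' j = \sum_(j < n) F j + (F' k - F k) + (F' k.+1 - F k.+1).
Proof.
move=> kn FF'.
have k0 : (k < n)%N by apply: ltnW.
rewrite (bigD1 (Ordinal k0)) //= (bigD1 (Ordinal kn)) /=; last first.
  by rewrite -val_eqE /= gtn_eqF.
rewrite [in RHS](bigD1 (Ordinal k0)) //= [in RHS](bigD1 (Ordinal kn)) /=; last first.
  by rewrite -val_eqE /= gtn_eqF.
rewrite (eq_bigr (fun j : 'I_n => F j)); first by lra.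
move=> i /andP[]; rewrite -!val_eqE /= => /eqP i1 /eqP i2.
exact: FF'.
Qed.

Lemma sum_exchange (R : realType) (a : nat -> R) n k mu : (k.+1 < n)%N ->
  \sum_(j < n) exchange a k mu j = \sum_(j < n) a j.
Proof.
move=> kn; rewrite (sum_update2 kn (@exchange_out _ a k mu)) exchangeE1 exchangeE2.
by ring.
Qed.

(** An exchange is a symmetric matrix, so a move on the levels can be carried over to the
    weights. *)
Lemma exchange_adjoint (R : realType) (a b : nat -> R) n k mu : (k.+1 < n)%N ->
  \sum_(j < n) a j * exchange b k mu j = \sum_(j < n) exchange a k mu j * b j.
Proof.
move=> kn.
rewrite (@sum_update2 _ (fun j => a j * b j) (fun j => a j * exchange b k mu j) _ _ kn);
  last by move=> j j1 j2; rewrite exchange_out.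
rewrite (@sum_update2 _ (fun j => a j * b j) (fun j => exchange a k mu j * b j) _ _ kn);
  last by move=> j j1 j2; rewrite exchange_out.
rewrite !exchangeE1 !exchangeE2; ring.
Qed.

Definition unimodal (R : realType) (xi : nat -> R) (m : nat) : Prop :=
  (forall j, (j < m)%N -> xi j <= xi j.+1) /\
  (forall j, (m <= j)%N -> xi j.+1 <= xi j).

Lemma exchange_between (R : realType) (a b mu : R) : 0 < mu <= 2^-1 -> a <= b ->
  [/\ a <= a + mu * (b - a), a + mu * (b - a) <= b + mu * (a - b)
    & b + mu * (a - b) <= b].
Proof. by move=> /andP[mu0 mu1] ab; split; nra. Qed.

(** As [mu] is at most 1/2, the two new values keep their order and lie between the old ones. Only
    comparisons with the outer neighbours can fail, and only if [k] or [k.+1] is the mode; then the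
    mode shifts by one cell. *)
Lemma unimodal_exchange (R : realType) (xi : nat -> R) m k mu :
  0 < mu <= 2^-1 -> unimodal xi m -> exists m', unimodal (exchange xi k mu) m'.
Proof.
move=> mu01 [up down].
set xi' := exchange xi k mu.
have out j : j <> k -> j <> k.+1 -> xi' j = xi j by exact: exchange_out.
have step j : [\/ j.+1 = k, j = k, j = k.+1
    | [/\ j.+1 <> k, j <> k, j <> k.+1, xi' j = xi j & xi' j.+1 = xi j.+1]].
  have [|jk1] := eqVneq j.+1 k; first by constructor 1.
  have [|jk2] := eqVneq j k; first by constructor 2.
  have [|jk3] := eqVneq j k.+1; first by constructor 3.
  by constructor 4; split; try exact/eqP; apply: out; lia.
have [km|mk] := ltnP k m.
  have [h1 h2 h3] := exchange_between mu01 (up _ km).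
  rewrite -exchangeE1 -exchangeE2 -/xi' in h1 h2 h3.
  have upk j : j.+1 = k -> xi' j <= xi' k.
    move=> jk; rewrite (out j); [|lia|lia]; apply: le_trans h1.
    by rewrite -jk; apply: up; lia.
  have [mk|mk] := ltnP k.+1 m.
    exists m; split=> j jm; case: (step j) => [jk|jk|jk|[j0 j1 j2 -> ->]].
    - by rewrite jk; apply: upk.
    - by subst j.
    - by subst j; rewrite (out k.+2); [apply: le_trans h3 _; exact: up|lia|lia].
    - exact: up.
    - by lia.
    - by lia.
    - by lia.
    - exact: down.
  have {mk} em : m = k.+1 by lia.
  have dn : xi k.+2 <= xi k.+1 by apply: down; lia.
  (* The value at the old mode [k.+1] has dropped, so [k.+2] may take over as the mode. *)
  have [h4|h4] := leP (xi' k.+2) (xi' k.+1).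
    exists k.+1; split=> j jm; case: (step j) => [jk|jk|jk|[j0 j1 j2 -> ->]].
    - by rewrite jk; apply: upk.
    - by subst j.
    - by lia.
    - by apply: up; lia.
    - by lia.
    - by lia.
    - by subst j.
    - by apply: down; lia.
  exists k.+2; split=> j jm; case: (step j) => [jk|jk|jk|[j0 j1 j2 -> ->]].
  - by rewrite jk; apply: upk.
  - by subst j.
  - by subst j; apply: ltW.
  - by apply: up; lia.
  - by lia.
  - by lia.
  - by lia.
  - by apply: down; lia.
have [h3 h2 h1] : [/\ xi k.+1 <= xi' k.+1, xi' k.+1 <= xi' k & xi' k <= xi k].
  rewrite /xi' exchangeE1 exchangeE2.
  exact: exchange_between mu01 (down _ mk).
have dnk : xi' k.+2 <= xi' k.+1.
  by rewrite (out k.+2); [apply: le_trans h3; apply: down; lia|lia|lia].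
have [{}mk|mk'] := ltnP m k.
  exists m; split=> j jm; case: (step j) => [jk|jk|jk|[j0 j1 j2 -> ->]].
  - by lia.
  - by lia.
  - by lia.
  - exact: up.
  - rewrite jk (out j); [|lia|lia]; apply: le_trans h1 _.
    by rewrite -jk; apply: down; lia.
  - by subst j.
  - by subst j.
  - exact: down.
have {mk mk'} em : m = k by lia.
(* Here the value at the mode [k] has dropped, and [k.-1], if it exists, may take over. *)
have [h4|h4] : (forall j, j.+1 = k -> xi' j <= xi' k) \/ (0 < k)%N /\ xi' k <= xi' k.-1.
  case: (k) => [|k']; first by left.
  have [h4|h4] := leP (xi' k') (xi' k'.+1); first by left=> j [->].
  by right; split=> //; exact: ltW.
  exists k; split=> j jm; case: (step j) => [jk|jk|jk|[j0 j1 j2 -> ->]].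
  - by rewrite jk; apply: h4.
  - by lia.
  - by lia.
  - by apply: up; lia.
  - by lia.
  - by subst j.
  - by subst j.
  - by apply: down; lia.
case: h4 => k0 h4; exists k.-1; split=> j jm; case: (step j) => [jk|jk|jk|[j0 j1 j2 -> ->]].
- by lia.
- by lia.
- by lia.
- by apply: up; lia.
- have -> : j = k.-1 by lia.
  by rewrite prednK.
- by subst j.
- by subst j.
- by apply: down; lia.
Qed.

(* Peel the weights off layer by layer, from whichever end is the lower one:
   each layer is the indicator of an interval containing the mode. *)
Lemma unimodal_sum_le (R : realType) (xi gam : nat -> R) m K : unimodal xi m ->
  (forall j, 0 <= xi j) ->
  (forall x y, (x <= m)%N -> (m < y)%N -> \sum_(x <= j < y) gam j <= K) ->
  forall x y, (x <= m)%N -> (m < y)%N ->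
  \sum_(x <= j < y) xi j * gam j <= K * xi m.
Proof.
move=> [up down] xi0 gamK.
have upm j : (j <= m)%N -> xi j <= xi m.
  move=> jm; have -> : j = (m - (m - j))%N by lia.
  elim: (m - j)%N => [|i IH]; first by rewrite subn0.
  have [im|im] := ltnP i m; last by have -> : (m - i.+1 = m - i)%N by lia.
  apply: le_trans IH; have -> : (m - i = (m - i.+1).+1)%N by lia.
  by apply: up; lia.
have downm j : (m <= j)%N -> xi j <= xi m.
  move=> jm; have -> : j = (m + (j - m))%N by lia.
  elim: (j - m)%N => [|i IH]; first by rewrite addn0.
  by apply: le_trans IH; rewrite addnS; apply: down; lia.
(* The height [t] has already been peeled off; the induction is on the length of the remaining
   interval. *)
have main l : forall x y t, (y - x <= l)%N -> (x <= m)%N -> (m < y)%N ->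
    t <= xi x -> t <= xi y.-1 ->
    \sum_(x <= j < y) (xi j - t) * gam j <= K * (xi m - t).
  elim: l => [|l IH] x y t yx xm my tx ty; first by lia.
  have peel s x' y' : (x <= x')%N -> (y' <= y)%N -> (x' <= m)%N -> (m < y')%N ->
      (y' - x' <= l)%N -> t <= s -> s <= xi x' -> s <= xi y'.-1 ->
      \sum_(x <= j < y) (xi j - s) * gam j = \sum_(x' <= j < y') (xi j - s) * gam j ->
      \sum_(x <= j < y) (xi j - t) * gam j <= K * (xi m - t).
    move=> xx' yy' xm' my' l' ts sx sy E.
    have -> : \sum_(x <= j < y) (xi j - t) * gam j =
      \sum_(x <= j < y) (xi j - s) * gam j + (s - t) * \sum_(x <= j < y) gam j.
      rewrite mulr_sumr -big_split /=; apply: eq_bigr => j _; ring.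
    rewrite E; have := IH _ _ _ l' xm' my' sx sy; have := gamK _ _ xm my.
    by nra.
  have [xlt|xeq] := ltnP x m.
    have [lxy|lyx] := leP (xi x) (xi y.-1).
      apply: (peel (xi x) x.+1 y) => //; try lia; first exact: up.
      by rewrite big_ltn ?subrr ?mul0r ?add0r //; lia.
    have [ylt|yeq] := ltnP m y.-1; last first.
      have E : y.-1 = m by lia.
      by rewrite E in lyx; have := upm _ xm; rewrite leNgt lyx.
    case: y my yx ty lyx ylt peel => // y /= my yx ty lyx ylt peel.
    apply: (peel (xi y) x y) => //; try lia; first exact: ltW.
      by case: y ylt {my yx ty lyx peel} => // y /= my; apply: down; lia.
    by rewrite big_nat_recr /=; [rewrite subrr mul0r addr0|lia].
  have ex : x = m by lia.
  subst x; have [ylt|yeq] := ltnP m y.-1; last first.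
    have -> : y = m.+1 by lia.
    rewrite big_nat1; have := gamK m m.+1 (leqnn _) (ltnSn _).
    by rewrite big_nat1; nra.
  case: y my yx ty ylt peel => // y /= my yx ty ylt peel.
  apply: (peel (xi y) m y) => //; try lia; first by apply: downm; lia.
    by case: y ylt {my yx ty peel} => // y /= my; apply: down; lia.
  by rewrite big_nat_recr /=; [rewrite subrr mul0r addr0|lia].
move=> x y xm my; have := main (y - x)%N x y 0 (leqnn _) xm my (xi0 _) (xi0 _).
rewrite subr0; apply: le_trans; apply: ler_sum => j _; by rewrite subr0.
Qed.

(** In terms of partial sums an exchange is local: it alters the single value at [k.+1], which is
    averaged with its two neighbours. *)
Definition height (R : realType) (xi : nat -> R) (p : nat) : R := \sum_(j < p) xi j.

Lemma heightS (R : realType) (xi : nat -> R) p : height xi p.+1 = height xi p + xi p.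
Proof. by rewrite /height big_ord_recr. Qed.

Lemma height_exchange_neq (R : realType) (xi : nat -> R) k mu p : p <> k.+1 ->
  height (exchange xi k mu) p = height xi p.
Proof.
have low q : (q <= k)%N -> height (exchange xi k mu) q = height xi q.
  move=> qk; apply: eq_bigr => i _; rewrite exchange_out //; have := ltn_ord i; lia.
have [/low//|kp pk] := leqP p k.
by rewrite /height sum_exchange //; lia.
Qed.

Lemma height_exchange (R : realType) (xi : nat -> R) k mu :
  height (exchange xi k mu) k.+1 =
  (1 - mu - mu) * height xi k.+1 + mu * (height xi k + height xi k.+2).
Proof.
rewrite !heightS height_exchange_neq; last by lia.
by rewrite exchangeE1; ring.
Qed.

Lemma height_mono (R : realType) (xi : nat -> R) x y : (forall j, 0 <= xi j) ->
  (x <= y)%N -> height xi x <= height xi y.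
Proof.
move=> xi0 xy; rewrite -(subnKC xy); elim: (y - x)%N => [|i IH]; first by rewrite addn0.
by rewrite addnS heightS; apply: le_trans IH _; rewrite lerDl.
Qed.

(* What one unit of water started at c can put into the cells x, .., y - 1. *)
Definition spread (R : realType) (xi : nat -> R) (c n : nat) : Prop :=
  [/\ forall j, 0 <= xi j, height xi n = 1,
      forall x y, (c <= x <= y)%N -> (y <= n)%N ->
        (y%:R - c%:R) * (height xi y - height xi x) <= y%:R - x%:R
    & forall x y, (x <= y <= c.+1)%N ->
        (c.+1%:R - x%:R) * (height xi y - height xi x) <= y%:R - x%:R].

Lemma exchange_ge0 (R : realType) (xi : nat -> R) k mu : 0 < mu <= 2^-1 ->
  (forall j, 0 <= xi j) -> forall j, 0 <= exchange xi k mu j.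
Proof.
move=> /andP[mu0 mu1] xi0 j; rewrite /exchange.
have := xi0 k; have := xi0 k.+1; have := xi0 j.
by case: ifP => _; [|case: ifP => _]; nra.
Qed.

(* The function a |-> 1 - e / a is concave. *)
Lemma mix_le (R : realType) (a e D0 D1 D2 mu : R) : 0 < mu <= 2^-1 -> 1 < a -> 0 <= e ->
  a * D0 <= a - e -> (a - 1) * D1 <= a - 1 - e -> (a + 1) * D2 <= a + 1 - e ->
  a * ((1 - mu - mu) * D0 + mu * (D1 + D2)) <= a - e.
Proof.
move=> /andP[mu0 mu1] a1 e0 h0 h1 h2.
have am : 0 < a - 1 by lra.
have ap : 0 < a + 1 by lra.
have {}h1 : D1 <= (a - 1 - e) / (a - 1) by rewrite ler_pdivlMr // mulrC.
have {}h2 : D2 <= (a + 1 - e) / (a + 1) by rewrite ler_pdivlMr // mulrC.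
have h3 : a * ((a - 1 - e) / (a - 1) + (a + 1 - e) / (a + 1)) <= 2 * (a - e).
  have -> : a * ((a - 1 - e) / (a - 1) + (a + 1 - e) / (a + 1)) =
    2 * (a - e) - e * (2 / ((a - 1) * (a + 1))).
    by field; apply/andP; split; apply: lt0r_neq0.
  rewrite lerBlDr lerDl mulr_ge0 // divr_ge0 // mulr_ge0 //; exact: ltW.
have h4 : a * (D1 + D2) <= 2 * (a - e).
  apply: le_trans h3; rewrite ler_pM2l; last by lra.
  exact: lerD.
nra.
Qed.

(** The right-hand bound on a height difference is 1 - (x - c) / (y - c), affine in x and concave in
    y. A changed height at x is thus handled by plain averaging and one at y by [mix_le]. The
    left-hand bound is the mirror image, with the roles of x and y interchanged. *)
Lemma spread_exchange (R : realType) (xi : nat -> R) c n k mu : 0 < mu <= 2^-1 ->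
  (c < n)%N -> (k.+1 < n)%N -> spread xi c n -> spread (exchange xi k mu) c n.
Proof.
move=> mu01 cn kn [xi0 xi1 right left].
have xi0' := @exchange_ge0 _ _ k _ mu01 xi0.
have xi1' : height (exchange xi k mu) n = 1 by rewrite height_exchange_neq //; lia.
have mu0 : 0 <= mu by lra.
have mu1 : 0 <= 1 - mu - mu by lra.
have le1 x y : (x <= y <= n)%N ->
    height (exchange xi k mu) y - height (exchange xi k mu) x <= 1.
  move=> /andP[xy yn]; rewrite -xi1' lerBlDr -[leLHS]addr0 lerD //.
    exact: height_mono.
  exact: sumr_ge0.
split=> // x y.
  move=> /andP[cx xy] yn.
  have [->|xney] := eqVneq x y; first by rewrite !subrr mulr0.
  (* For x = c the bound only says that the total mass is 1. With this case gone, c <= k holds when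
     x = k.+1, so the old bound at [k] is available. *)
  have [->|xc] := eqVneq x c.
    have -> : y%:R - c%:R = (y - c)%:R :> R by rewrite natrB //; lia.
    by rewrite -[leRHS]mulr1 ler_wpM2l // le1 //; lia.
  have [yk|yk] := eqVneq y k.+1.
    rewrite yk height_exchange height_exchange_neq; last by lia.
    have h0 := right x k.+1 ltac:(lia) ltac:(lia).
    have h1 := right x k ltac:(lia) ltac:(lia).
    have h2 := right x k.+2 ltac:(lia) ltac:(lia).
    rewrite (_ : _ - height xi x = (1 - mu - mu) * (height xi k.+1 - height xi x)
      + mu * ((height xi k - height xi x) + (height xi k.+2 - height xi x))); last by ring.
    rewrite (_ : k.+1%:R - x%:R = k.+1%:R - c%:R - (x%:R - c%:R)); last by ring.
    have ck : c.+1%:R <= k%:R :> R by rewrite ler_nat; lia.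
    have cx' : c%:R <= x%:R :> R by rewrite ler_nat.
    rewrite -!natr1 in ck h0 h1 h2 *.
    by apply: mix_le => //; lra.
  have [xk|xk] := eqVneq x k.+1.
    rewrite xk height_exchange height_exchange_neq; last by lia.
    have h0 := right k.+1 y ltac:(lia) ltac:(lia).
    have h1 := right k y ltac:(lia) ltac:(lia).
    have h2 := right k.+2 y ltac:(lia) ltac:(lia).
    by move: h0 h1 h2; rewrite -?natr1; nra.
  rewrite !height_exchange_neq; [apply: right => //|exact/eqP..].
  by rewrite cx.
move=> /andP[xy yc].
have [->|xney] := eqVneq x y; first by rewrite !subrr mulr0.
have [->|yc'] := eqVneq y c.+1.
  have -> : c.+1%:R - x%:R = (c.+1 - x)%:R :> R by rewrite natrB //; lia.
  by rewrite -[leRHS]mulr1 ler_wpM2l // le1 //; lia.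
have [yk|yk] := eqVneq y k.+1.
  rewrite yk height_exchange height_exchange_neq; last by lia.
  have h0 := left x k.+1 ltac:(lia).
  have h1 := left x k ltac:(lia).
  have h2 := left x k.+2 ltac:(lia).
  by move: h0 h1 h2; rewrite -?natr1; nra.
have [xk|xk] := eqVneq x k.+1.
  rewrite xk height_exchange height_exchange_neq; last by lia.
  have h0 := left k.+1 y ltac:(lia).
  have h1 := left k y ltac:(lia).
  have h2 := left k.+2 y ltac:(lia).
  rewrite (_ : height xi y - _ = (1 - mu - mu) * (height xi y - height xi k.+1)
      + mu * ((height xi y - height xi k.+2) + (height xi y - height xi k))); last by ring.
  rewrite (_ : y%:R - k.+1%:R = c.+1%:R - k.+1%:R - (c.+1%:R - y%:R)); last by ring.
  have ck : k.+2%:R <= c%:R :> R by rewrite ler_nat; lia.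
  have cy : y%:R <= c.+1%:R :> R by rewrite ler_nat.
  rewrite -!natr1 in ck cy h0 h1 h2 *.
  by apply: mix_le => //; lra.
rewrite !height_exchange_neq; [apply: left => //|exact/eqP..].
by rewrite xy.
Qed.

(** Together the inequalities say that [xi m] is at most 1 / (|m - c| + 1). One of them is the
    spread bound for the single cell [m]; the other has a nonpositive left-hand side. *)
Lemma spread_point_le (R : realType) (xi : nat -> R) c n m : (m < n)%N -> spread xi c n ->
  (m%:R - c%:R) * xi m <= 1 - xi m /\ (c%:R - m%:R) * xi m <= 1 - xi m.
Proof.
move=> mn [xi0 xi1 right left].
have xim : xi m <= 1.
  have := height_mono xi0 mn; rewrite xi1 heightS.
  suff : 0 <= height xi m by lra.
  exact: sumr_ge0.
have := xi0 m.
have [mc|cm] := ltnP m c.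
  have mc' : m%:R <= c%:R :> R by rewrite ler_nat; lia.
  by have := left m m.+1; rewrite heightS -!natr1 => /(_ ltac:(lia)); split; nra.
have mc' : c%:R <= m%:R :> R by rewrite ler_nat; lia.
by have := right m m.+1; rewrite heightS -!natr1 => /(_ ltac:(lia) ltac:(lia)); split; nra.
Qed.

Section PathMoves.
Variables (R : realType) (G : sgraph) (e : nat -> G) (n : nat).
Hypothesis e_inj : {in gtn n &, injective e}.

Definition path_move (m : move R G) : Prop :=
  exists2 k, (k.+1 < n)%N &
    (src m = e k /\ tgt m = e k.+1) \/ (src m = e k.+1 /\ tgt m = e k).

Lemma do_move_exchange (eta : G -> R) (m : move R G) k : (k.+1 < n)%N ->
  (src m = e k /\ tgt m = e k.+1) \/ (src m = e k.+1 /\ tgt m = e k) ->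
  forall j, (j < n)%N -> do_move eta m (e j) = exchange (eta \o e) k (Defs.frac m) j.
Proof.
case: m => x y mu kn /= xy j jn.
have eE i : (i < n)%N -> (e j == e i) = (j == i).
  by move=> i_n; apply/eqP/eqP => [/e_inj -> //|->].
rewrite /exchange /=; case: xy => -[-> ->]; rewrite !eE //; try lia.
case: eqVneq => [->|//]; by case: eqVneq => // ?; lia.
Qed.

Lemma height_delta (c p : nat) :
  height (fun j => (j == c)%:R : R) p = (c < p)%N%:R.
Proof.
elim: p => [|p IH]; first by rewrite /height big_ord0.
by rewrite heightS IH ltnS; case: ltngtP => _ /=; rewrite ?addr0 ?add0r.
Qed.

(** By self-adjointness, the weights of the final level at [e c] arise from a unit mass at [c] by
    performing the moves in reverse order. They inherit unimodality and the spread bounds from that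
    unit mass. *)
Lemma path_move_dual (c : nat) (s : seq (move R G)) : (c < n)%N ->
  all (@legal_move R G) s -> (forall m, List.In m s -> path_move m) ->
  exists xi, [/\ exists m, unimodal xi m, spread xi c n,
    forall j, (n <= j)%N -> xi j = 0
    & forall eta, do_moves eta s (e c) = \sum_(j < n) xi j * eta (e j)].
Proof.
move=> cn; elim: s => [_ _|m s IH /= /andP[lm ls] sp].
  exists (fun j => (j == c)%:R); split.
  - exists c; split=> j jc; rewrite ler_nat; by do 2 case: eqP => //; lia.
  - split.
    + by move=> j; rewrite ler0n.
    + by rewrite height_delta cn.
    + move=> x y /andP[cx xy] yn; rewrite !height_delta.
      have [xc|xc] := ltnP c x; first by rewrite (leq_trans xc xy) subrr mulr0 subr_ge0 ler_nat.
      have -> : x = c by lia.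
      have [yc|yc] := ltnP c y; first by rewrite subr0 mulr1.
      have -> : y = c by lia.
      by rewrite !subrr mul0r.
    + move=> x y /andP[xy yc]; rewrite !height_delta.
      have [cx|xc] := ltnP c x.
        have -> : y = x by lia.
        by rewrite cx !subrr mulr0.
      have [cy|_] := ltnP c y; last by rewrite subrr mulr0 subr_ge0 ler_nat.
      have -> : y = c.+1 by lia.
      by rewrite subr0 mulr1.
  - by move=> j nj; case: eqP => // ?; lia.
  - move=> eta /=; rewrite (bigD1 (Ordinal cn)) //= eqxx mul1r big1 ?addr0 //.
    by move=> i; rewrite -val_eqE /= => /negbTE ->; rewrite mul0r.
have [xi [[m0 um] sp_xi xi0 xiE]] := IH ls (fun m' h => sp m' (or_intror h)).
have [k kn mk] := sp m (or_introl erefl).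
have mu01 : 0 < Defs.frac m <= 2^-1 by case/and3P: lm => _ -> ->.
exists (exchange xi k (Defs.frac m)); split.
- exact: unimodal_exchange um.
- exact: spread_exchange.
- by move=> j nj; rewrite exchange_out; [exact: xi0|lia|lia].
- move=> eta /=; rewrite xiE -(exchange_adjoint xi (eta \o e) _ kn); apply: eq_bigr => j _.
  by rewrite (do_move_exchange eta kn mk).
Qed.

End PathMoves.

(** * Levels on the line when partial sums stay in a cone around slope 1/2 *)

Definition in_cone (R : realType) (a : nat -> R) : Prop :=
  forall n, 2/5 * n%:R <= \sum_(i < n) a i <= 3/5 * n%:R.

Lemma sum_window (R : realType) (a : nat -> R) x y : (x <= y)%N ->
  \sum_(x <= j < y) a j = \sum_(i < y - x) a (x + i)%N.
Proof.
move=> xy; rewrite -{1}[x]add0n big_addn big_mkord.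
by apply: eq_bigr => i _; rewrite addnC.
Qed.

(** If the interval meets both sides of the cut after [c], the two upper bounds add up to at most 0.
    Otherwise it is a difference of two intervals starting at the cut, and the gap 1/5 between the
    slopes is paid on the shorter one, of length at most |m - c|. *)
Lemma cone_interval_le (R : realType) (a : nat -> R) c m x y :
  in_cone (fun i => a (c.+1 + i)%N) ->
  (forall q, (q <= c.+1)%N ->
     2/5 * q%:R <= \sum_(c.+1 - q <= j < c.+1) a j <= 3/5 * q%:R) ->
  (x <= m)%N -> (m < y)%N ->
  \sum_(x <= j < y) (a j - 3/5) <= 1/5 * `|m%:R - c%:R|.
Proof.
move=> right left xm my.
rewrite big_split /= sumrN sumr_const_nat -[3/5 *+ _]mulr_natr.
have le_abs : (m%:R - c%:R : R) <= `|m%:R - c%:R| by exact: ler_norm.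
have le_abs' : (c%:R - m%:R : R) <= `|m%:R - c%:R|.
  by rewrite distrC ler_norm.
have {}right q : (c.+1 <= q)%N -> 2/5 * (q%:R - c%:R - 1) <=
    \sum_(c.+1 <= j < q) a j <= 3/5 * (q%:R - c%:R - 1).
  move=> cq; rewrite sum_window //; have := right (q - c.+1)%N.
  by rewrite natrB // -natr1; lra.
have {}left q : (q <= c.+1)%N -> 2/5 * (c%:R + 1 - q%:R) <=
    \sum_(q <= j < c.+1) a j <= 3/5 * (c%:R + 1 - q%:R).
  move=> cq; have := left (c.+1 - q)%N; rewrite subKn // natrB // -natr1.
  by move=> /(_ ltac:(lia)); lra.
rewrite natrB; last by lia.
have [xc|cx] := leqP x c; last first.
  have := right x cx; have := right y ltac:(lia).
  rewrite (@big_cat_nat _ _ _ x c.+1 y) //=; last by lia.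
  have : x%:R <= m%:R :> R by rewrite ler_nat.
  by lra.
have [cy|yc] := ltnP c y.
  have := left x ltac:(lia); have := right y cy.
  rewrite (@big_cat_nat _ _ _ c.+1 x y) //=; last by lia.
  have := normr_ge0 (m%:R - c%:R : R).
  by lra.
have := left x ltac:(lia); have := left y ltac:(lia).
rewrite (@big_cat_nat _ _ _ y x c.+1) //=; [|lia|lia].
have : m.+1%:R <= y%:R :> R by rewrite ler_nat.
by rewrite -natr1; lra.
Qed.

(** The weights sum to 1, so the excess over 3/5 is at most 1/5 * |m - c| * [xi m], where [xi m] is
    at most 1 / (|m - c| + 1). *)
Lemma cone_level_le (R : realType) (xi a : nat -> R) c n m : (c < n)%N ->
  unimodal xi m -> spread xi c n -> (forall j, (n <= j)%N -> xi j = 0) ->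
  in_cone (fun i => a (c.+1 + i)%N) ->
  (forall q, (q <= c.+1)%N ->
     2/5 * q%:R <= \sum_(c.+1 - q <= j < c.+1) a j <= 3/5 * q%:R) ->
  \sum_(j < n) xi j * a j <= 4/5.
Proof.
move=> cn um sp_xi xin right left.
have [xi0 xi1 _ _] := sp_xi.
(* If the mode were at [n] or beyond, the weights would increase up to the value 0 and could not
   have total mass 1. *)
have mn : (m < n)%N.
  rewrite ltnNge; apply/negP => nm.
  have upm j : (j <= m)%N -> xi j <= 0.
    move=> jm; rewrite -(xin _ nm) -(subKn jm).
    elim: (m - j)%N => [|i IH]; first by rewrite subn0.
    have [im|im] := ltnP i m; last by have -> : (m - i.+1 = m - i)%N by lia.
    apply: le_trans IH; have -> : (m - i = (m - i.+1).+1)%N by lia.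
    by case: um => up _; apply: up; lia.
  have : height xi n <= 0.
    by apply: sumr_le0 => i _; apply: upm; have := ltn_ord i; lia.
  by rewrite xi1 ler10.
have := unimodal_sum_le um xi0 (fun x y => @cone_interval_le _ a c m x y right left) (leq0n m) mn.
rewrite big_mkord.
rewrite (eq_bigr (fun i : 'I_n => xi i * a i + - (3/5) * xi i)); last by move=> i _; ring.
rewrite big_split /= -mulr_sumr -/(height xi n) xi1.
have [] := spread_point_le mn sp_xi.
have := xi0 m.
by case: ler0P => _; nra.
Qed.

Lemma line_level_le (R : realType) (G : sgraph) (g : int -> G) (f : G -> int)
    (fK : cancel f g) (gK : cancel g f)
    (gadj : forall i j, adj (g i) (g j) = int_adj i j) (eta : G -> R) :
  in_cone (fun i => eta (g (i%:Z + 1))) -> in_cone (fun i => eta (g (- i%:Z))) ->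
  forall s, all (@legal_move R G) s -> do_moves eta s (g 0) <= 4/5.
Proof.
move=> right left s ls.
(* Finitely many moves touch a bounded segment; shifted by [B] it becomes a path of 2B + 1 cells
   with the vertex 0 at index [B]. *)
have [B sB] : exists B : nat, forall m, List.In m s ->
    (`|f (src m)| < B)%N /\ (`|f (tgt m)| < B)%N.
  elim: s {ls} => [|m s [B IH]]; first by exists 0%N.
  exists (maxn B (maxn `|f (src m)| `|f (tgt m)|).+1) => m' /= [<-|/IH]; lia.
pose e k := g (k%:Z - B%:Z).
have e_inj : {in gtn (B + B.+1)%N &, injective e}.
  by move=> i j _ _ /(can_inj gK); lia.
have cn : (B < B + B.+1)%N by lia.
have sp : forall m, List.In m s -> path_move e (B + B.+1) m.
  move=> m ms; have [mB1 mB2] := sB _ ms.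
  have : legal_move m.
    elim: s ls ms {sB} => //= a s IH /andP[la ls] [<-//|]; exact: IH.
  case/and3P; rewrite -[src m]fK -[tgt m]fK gadj => /orP[/eqP E|/eqP E] _ _.
    exists `|(f (src m) + B%:Z)%R|%N; first by lia.
    left; split; rewrite /e -{1}[_ m]fK; congr g; lia.
  exists `|(f (tgt m) + B%:Z)%R|%N; first by lia.
  right; split; rewrite /e -{1}[_ m]fK; congr g; lia.
have [xi [[m um] sp_xi xi0 xiE]] := path_move_dual e_inj cn ls sp.
have -> : g 0 = e B by rewrite /e subrr.
rewrite xiE; apply: (cone_level_le cn um sp_xi xi0 (a := eta \o e)).
  move=> q; have := right q; rewrite (_ : \sum_(i < q) _ = \sum_(i < q) (eta \o e) (B.+1 + i)%N) //.
  by apply: eq_bigr => i _; rewrite /= /e; congr (eta (g _)); lia.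
move=> q qB; have := left q; rewrite (_ : \sum_(i < q) _ = \sum_(B.+1 - q <= j < B.+1) (eta \o e) j) //.
rewrite sum_window; last by lia.
rewrite subKn // (reindex_inj rev_ord_inj) /=; apply: eq_bigr => i _.
by rewrite /= /e; congr (eta (g _)); have := ltn_ord i; lia.
Qed.

(** * Raising the level along a comb *)

Lemma do_moves_cat (R : realType) (G : sgraph) (eta : G -> R) s1 s2 :
  do_moves eta (s1 ++ s2) = do_moves (do_moves eta s1) s2.
Proof. by rewrite /do_moves foldl_cat. Qed.

(* Averaging along an edge with difference d lowers the sum of the squared levels
   by d ^ 2 / 2, so a sequence that almost minimizes this energy almost
   equalizes all levels. *)
Lemma equalize_path (R : realType) (G : sgraph) (eta : G -> R) (e : nat -> G) n :
  {in gtn n.+1 &, injective e} ->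
  (forall k, (k < n)%N -> adj (e k) (e k.+1)) ->
  forall dlt : R, 0 < dlt -> exists s, [/\ all (@legal_move R G) s,
    forall w, (forall j, (j <= n)%N -> w <> e j) -> do_moves eta s w = eta w
    & forall j, (j <= n)%N ->
        (\sum_(i < n.+1) eta (e i)) / n.+1%:R - dlt <= do_moves eta s (e j)].
Proof.
move=> e_inj e_adj dlt dlt0.
pose mv k : move R G := Move (e k) (e k.+1) 2^-1.
pose ok (s : seq nat) := all (gtn n) s.
pose lev s := do_moves eta (map mv s) \o e.
pose E s := \sum_(j < n.+1) (lev s j) ^+ 2.
have lev_rcons s k j : (k < n)%N -> (j < n.+1)%N ->
    lev (rcons s k) j = exchange (lev s) k 2^-1 j.
  move=> kn jn; rewrite /lev map_rcons -cats1 do_moves_cat.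
  by apply: (@do_move_exchange _ _ e _ e_inj _ (mv k)) => //; left.
have inf_ok : has_inf [set E s | s in ok].
  split; first by exists (E [::]), [::].
  by exists 0 => _ [s _ <-]; apply: sumr_ge0 => j _; apply: sqr_ge0.
(* At most [n] successive differences of size [eps] then add up to at most [dlt]. *)
pose eps := dlt / n.+1%:R.
have eps0 : 0 < eps by rewrite divr_gt0.
have eps2 : 0 < eps ^+ 2 / 2 by rewrite divr_gt0 // exprn_gt0.
have [_ [s oks <-] sE] := inf_adherent eps2 inf_ok.
(* A larger difference across the edge [k] would let one more averaging bring the energy below its
   infimum. *)
have close k : (k < n)%N -> `|lev s k.+1 - lev s k| <= eps.
  move=> kn.
  have : inf [set E s | s in ok] <= E (rcons s k).
    apply: ge_inf; first by case: inf_ok.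
    by exists (rcons s k) => //; rewrite /ok all_rcons /= kn.
  have -> : E (rcons s k) = E s - (lev s k.+1 - lev s k) ^+ 2 / 2.
    rewrite /E (eq_bigr (fun j : 'I_n.+1 => exchange (lev s) k 2^-1 j ^+ 2)); last first.
      by move=> j _; rewrite lev_rcons.
    rewrite (@sum_update2 _ (fun j => lev s j ^+ 2)
      (fun j => exchange (lev s) k 2^-1 j ^+ 2) n.+1 k kn).
      by rewrite exchangeE1 exchangeE2; field.
    by move=> j j1 j2; rewrite exchange_out.
  move=> infE; rewrite -(@ler_sqr _ _ eps) ?nnegrE ?(ltW eps0) // real_normK ?num_real //.
  by lra.
have mean : \sum_(i < n.+1) lev s i = \sum_(i < n.+1) eta (e i).
  elim/last_ind: s oks {sE close} => [//|s k IH].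
  rewrite /ok all_rcons => /andP[kn /IH <-].
  rewrite -(@sum_exchange _ (lev s) n.+1 k 2^-1) //.
  by apply: eq_bigr => i _; rewrite lev_rcons.
have far i j : (i <= j)%N -> (j <= n)%N -> `|lev s j - lev s i| <= (j - i)%:R * eps.
  move=> ij jn; rewrite -(subnKC ij); move: (j - i)%N (subnKC ij) => l ijl.
  elim: l j ij jn ijl => [|l IH] j ij jn ijl.
    by rewrite addn0 subrr normr0 subnn mul0r.
  have h1 := close (i + l)%N ltac:(lia).
  have := IH (i + l)%N ltac:(lia) ltac:(lia) erefl.
  rewrite !addKn addnS -[l.+1%:R]natr1 mulrDl mul1r => h2.
  apply: le_trans (ler_distD (lev s (i + l)%N) _ _) _.
  by rewrite addrC lerD.
have near_ i j : (i <= n)%N -> (j <= n)%N -> lev s i - dlt <= lev s j.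
  move=> ni nj.
  suff : `|lev s j - lev s i| <= dlt by rewrite ler_norml; lra.
  have small l : (l <= n)%N -> l%:R * eps <= dlt.
    move=> ln; have -> : dlt = n.+1%:R * eps by rewrite mulrC divfK.
    by rewrite ler_wpM2r ?(ltW eps0) // ler_nat; lia.
  have [ij|ji] := leqP i j; first by apply: le_trans (far _ _ ij nj) _; apply: small; lia.
  by rewrite distrC; apply: le_trans (far _ _ (ltnW ji) ni) _; apply: small; lia.
exists (map mv s); split.
- elim: s oks {sE close mean far near_} => //= k s IH /andP[kn /IH ->].
  by rewrite andbT /legal_move /= e_adj //= invr_gt0 ltr0n lexx.
- move=> w we; elim/last_ind: s oks {sE close mean far near_} => [//|s k IH].
  rewrite /ok all_rcons => /andP[/= kn /IH <-].
  rewrite map_rcons -cats1 do_moves_cat /=.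
  by case: eqP => [/we []|_]; [lia|case: eqP => [/we []|//]; lia].
- move=> j jn; rewrite -mean lerBlDr ler_pdivrMr ?ltr0n //.
  have -> : (do_moves eta (map mv s) (e j) + dlt) * n.+1%:R = \sum_(i < n.+1) (lev s j + dlt).
    by rewrite sumr_const card_ord mulr_natr.
  apply: ler_sum => i _; rewrite -lerBlDr; apply: near_ => //.
  by have := ltn_ord i.
Qed.

(** Distinct tips off the spine keep their initial levels until their own tooth is used; increasing
    feet make the segments of spine to be equalized nested. *)
Record comb (G : sgraph) (p : nat -> G) (N : nat -> nat) (ext : nat -> G) : Prop := Comb {
  spine_inj : injective p;
  spine_adj : forall i, adj (p i) (p i.+1);
  foot_increasing : {homo N : i j / (i < j)%N};
  tip_inj : injective ext;
  tip_off_spine : forall i j, ext i <> p j;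
  tip_adj : forall i, adj (p (N i)) (ext i) }.

(** The factor by which tooth [i] shrinks the gap to [h] on the spine: with the tip, the equalized
    path has [N i] + 2 vertices. A tip below [h] is left alone. *)
Definition tooth_factor (R : realType) (N : nat -> nat) (h : R) (i : nat) (x : R) : R :=
  if h <= x then 1 - (N i).+2%:R^-1 else 1.

Lemma tooth_factor_ge0 (R : realType) N (h : R) i x : 0 <= tooth_factor N h i x.
Proof.
rewrite /tooth_factor; case: ifP => // _.
by rewrite subr_ge0 invf_le1 ?ltr0n // ler1n.
Qed.

(* From the far end to the near one, equalize each good tooth with the whole
   spine between it and the target. *)
Lemma comb_level_ge (R : realType) (G : sgraph) (eta : G -> R) p N ext (h dlt : R) J :
  @comb G p N ext -> (forall u, 0 <= eta u) -> 0 <= h -> 0 < dlt ->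
  exists2 s, all (@legal_move R G) s &
    h * (1 - \prod_(i < J) tooth_factor N h i (eta (ext i))) - dlt <= do_moves eta s (p 0).
Proof.
move=> [p_inj p_adj N_inc ext_inj ext_p ext_adj] eta0 h0 dlt0.
pose W l := \prod_(l <= i < J) tooth_factor N h i (eta (ext i)).
have W0 l : 0 <= W l by apply: prodr_ge0 => i _; apply: tooth_factor_ge0.
pose t := dlt / J.+1%:R.
have t0 : 0 < t by rewrite divr_gt0.
(* The last [l] of the [J] teeth have been processed, each at a cost of at most [t] in precision.
   For [l] = 0 the bound is 0 on the whole spine. *)
have main l : (l <= J)%N -> exists s, [/\ all (@legal_move R G) s,
    forall i, (i < J - l)%N -> do_moves eta s (ext i) = eta (ext i)
    & forall j, l = 0%N \/ (j <= N (J - l))%N ->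
        h * (1 - W (J - l)%N) - l%:R * t <= do_moves eta s (p j)].
  elim: l => [_|l IH lJ].
    exists [::]; split=> //= j _.
    by rewrite /W subn0 big_geq // subrr mulr0 mul0r subr0 eta0.
  have [s [ls ext_s s_ge]] := IH (ltnW lJ).
  pose i := (J - l.+1)%N; have iE : (J - l = i.+1)%N by rewrite /i; lia.
  rewrite -/i; rewrite iE in ext_s s_ge.
  have s_gei j : (j <= N i)%N -> h * (1 - W i.+1) - l%:R * t <= do_moves eta s (p j).
    move=> jN; apply: s_ge; right; apply: leq_trans jN _; apply: ltnW.
    exact: N_inc.
  have WE : W i = tooth_factor N h i (eta (ext i)) * W i.+1.
    by rewrite /W big_ltn //; rewrite /i; lia.
  have [good|bad] := boolP (h <= eta (ext i)); last first.
    exists s; split=> //; first by move=> k ki; apply: ext_s; lia.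
    move=> j [//|jN]; apply: le_trans (s_gei j jN).
    rewrite WE /tooth_factor (negbTE bad) mul1r lerB // ler_wpM2r ?(ltW t0) //.
    by rewrite ler_nat.
  pose e k := if (k <= N i)%N then p k else ext i.
  have e_inj : {in gtn (N i).+2 &, injective e}.
    move=> k1 k2; rewrite !inE /e => h1 h2.
    case: leqP => k1N; case: leqP => k2N.
    - exact: p_inj.
    - by move=> E; case: (ext_p i k1).
    - by move=> /ext_p.
    - by move=> _; lia.
  have e_adj k : (k < (N i).+1)%N -> adj (e k) (e k.+1).
    rewrite /e ltnS => kN; rewrite kN; case: ltnP => // kN'.
    have -> : k = N i by lia.
    exact: ext_adj.
  have [s' [ls' out_s' s'_ge]] := equalize_path (do_moves eta s) e_inj e_adj t0.
  exists (s ++ s'); split.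
  - by rewrite all_cat ls.
  - move=> k ki; rewrite do_moves_cat out_s' ?ext_s //; first by lia.
    move=> j _; rewrite /e; case: ifP => _; first exact: ext_p.
    by move=> /ext_inj; lia.
  - move=> j [//|jN]; rewrite do_moves_cat.
    have := s'_ge j ltac:(lia); rewrite {2}/e jN; apply: le_trans.
    rewrite big_ord_recr /= {2}/e ltnn ext_s // WE /tooth_factor good.
    (* With [x] the level secured so far on the spine, the new mean is at least x + (h - x) / (N i +
       2). *)
    set x := h * (1 - W i.+1) - l%:R * t in s_gei *.
    have sum_ge : (N i).+1%:R * x <= \sum_(k < (N i).+1) do_moves eta s (e k).
      rewrite mulr_natl -[X in _ *+ X]card_ord -sumr_const; apply: ler_sum => k _.
      by rewrite /e -ltnS ltn_ord; apply: s_gei; have := ltn_ord k; lia.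
    set S := \sum_(k < _) _ in sum_ge *.
    have n0 : 0 < (N i).+2%:R :> R by rewrite ltr0n.
    have -> : l.+1%:R * t = l%:R * t + t by rewrite -natr1 mulrDl mul1r.
    rewrite [- (_ + t)]opprD addrA lerD2r.
    rewrite ler_pdivlMr //.
    have xh : h - x = h * W i.+1 + l%:R * t by rewrite /x; ring.
    have -> : (h * (1 - (1 - (N i).+2%:R^-1) * W i.+1) - l%:R * t) * (N i).+2%:R
       = x * (N i).+2%:R + h * W i.+1.
      by rewrite /x; field; apply: lt0r_neq0.
    rewrite -[(N i).+2%:R]natr1 in n0 *.
    have : 0 <= l%:R * t by rewrite mulr_ge0 // ltW.
    by lra.
have [s [ls _ s_ge]] := main J (leqnn J).
exists s => //; rewrite subnn in s_ge.
have := s_ge 0%N (or_intror (leq0n _)); rewrite /W big_mkord; apply: le_trans.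
rewrite lerB // /t mulrCA ger_pMr // ler_pdivrMr ?ltr0n // mul1r ler_nat.
exact: leqnSn.
Qed.

(** * Geodesic rays and combs in graphs *)

Section Distance.
Variables (G : sgraph) (Gconn : connected_graph G).

Definition walk (n : nat) (v w : G) : Prop :=
  exists2 p : seq G, path adj v p & last v p = w /\ size p = n.

Lemma walk_exists v w : exists n, `[< walk n v w >].
Proof.
by have [p vp pw] := Gconn v w; exists (size p); apply/asboolP; exists p.
Qed.

Definition dist v w : nat := ex_minn (walk_exists v w).

Lemma walk_dist v w : walk (dist v w) v w.
Proof. by rewrite /dist; case: ex_minnP => n /asboolP. Qed.

Lemma dist_le n v w : walk n v w -> (dist v w <= n)%N.
Proof. by move=> nvw; rewrite /dist; case: ex_minnP => m _; apply; apply/asboolP. Qed.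

Lemma walk_cat m n u v w : walk m u v -> walk n v w -> walk (m + n) u w.
Proof.
move=> [p up [pv pm]] [q vq [qw qn]]; exists (p ++ q).
  by rewrite cat_path up pv.
by rewrite last_cat pv qw size_cat pm qn.
Qed.

Lemma walk1 v w : adj v w -> walk 1 v w.
Proof. by move=> vw; exists [:: w] => //=; rewrite vw. Qed.

Lemma dist_triangle u v w : (dist u w <= dist u v + dist v w)%N.
Proof. by apply: dist_le; apply: walk_cat (walk_dist _ _) (walk_dist _ _). Qed.

Lemma distxx v : dist v v = 0%N.
Proof. by apply/eqP; rewrite -leqn0; apply: dist_le; exists [::]. Qed.

Lemma dist_eq0 v w : dist v w = 0%N -> v = w.
Proof. by have := walk_dist v w => -[[|x p] _ [<- <-]]. Qed.

Lemma dist_adj v x y : adj x y -> (dist v y <= (dist v x).+1)%N.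
Proof.
move=> xy; apply: leq_trans (dist_triangle v x y) _.
by rewrite -addn1 leq_add2l; apply/dist_le/walk1.
Qed.

Lemma dist_first n x w : dist x w = n.+1 -> exists2 y, adj x y & dist y w = n.
Proof.
move=> xwn; have := walk_dist x w; rewrite xwn => -[[|y p]] /=; first by move=> _ [].
move=> /andP[xy yp] [pw [pn]].
exists y => //; apply/eqP; rewrite eqn_leq; apply/andP; split.
  by apply: dist_le; exists p.
rewrite -ltnS -xwn; apply: leq_trans (dist_triangle x y w) _.
by rewrite -add1n leq_add2r; apply/dist_le/walk1.
Qed.

Hypothesis Gfin : forall x : G, finite_set [set w | adj x w].

(** The graph is the union of the balls around [v], which are finite because all degrees are. *)
Lemma graph_countable (v : G) : countable [set: G].
Proof.
have ball_fin n : finite_set [set w | (dist v w <= n)%N].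
  elim: n => [|n IH].
    apply: (@sub_finite_set _ _ [set v]); last exact: finite_set1.
    by move=> w /=; rewrite leqn0 => /eqP/dist_eq0.
  pose S := [set w | (dist v w <= n)%N].
  apply: (@sub_finite_set _ _ (S `|` \bigcup_(x in S) [set w | adj x w])).
    move=> w /= wn.
    have [wn'|wn'] := leqP (dist v w) n; first by left.
    have {}wn : dist v w = n.+1 by lia.
    have [p vp [pw pn]] := walk_dist v w.
    right; case/lastP: p vp pw pn => [|p y]; first by rewrite wn.
    rewrite rcons_path last_rcons size_rcons wn => /andP[vp py] <- [pn].
    by exists (last v p) => //; rewrite /S /= -pn; apply: dist_le; exists p.
  by rewrite finite_setU; split=> //; apply: bigcup_finite.
rewrite (_ : [set: G] = \bigcup_n [set w | (dist v w <= n)%N]).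
  by apply: bigcup_countable => // n _; apply: finite_set_countable.
by apply/seteqP; split=> // w _; exists (dist v w) => /=.
Qed.

Hypothesis Ginf : infinite_set [set: G].

(* König: infinitely many vertices lie on geodesics from v extending some
   geodesic to p i. *)
Lemma geodesic_ray (v : G) : exists p : nat -> G,
  [/\ p 0 = v, forall i, adj (p i) (p i.+1) & forall i, dist v (p i) = i].
Proof.
pose beyond x := [set w | dist v w = (dist v x + dist x w)%N].
have step x : infinite_set (beyond x) -> exists y,
    [/\ adj x y, dist v y = (dist v x).+1 & infinite_set (beyond y)].
  move=> xinf; apply: contrapT => /forallNP none; apply: xinf.
  pose S := [set y | adj x y /\ dist v y = (dist v x).+1].
  (* A geodesic from x to any other w beyond x starts with a neighbour y that is one step further
     from v, and w is beyond y too. *)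
  apply: (@sub_finite_set _ _ ([set x] `|` \bigcup_(y in S) beyond y)).
    rewrite /beyond => w /= wE; case xw: (dist x w) => [|n].
      by left; rewrite (dist_eq0 xw).
    have [y xy yw] := dist_first xw.
    have h1 := dist_triangle v y w; have h2 := dist_adj v xy.
    right; exists y; first split=> //. lia.
    by rewrite /beyond /=; lia.
  rewrite finite_setU; split; first exact: finite_set1.
  apply: bigcup_finite.
    by apply: sub_finite_set (Gfin x) => y [].
  move=> y [xy yd]; apply: contrapT => yinf.
  by apply: (none y).
pose ok := {x : G | infinite_set (beyond x)}.
have /choice[nxt nxtP] : forall x : ok, exists y : ok,
    adj (sval x) (sval y) /\ dist v (sval y) = (dist v (sval x)).+1.
  move=> [x xinf] /=; have [y [xy yd yinf]] := step x xinf.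
  by exists (exist _ y yinf).
have vinf : infinite_set (beyond v).
  rewrite (_ : beyond v = setT) //; apply/seteqP; split=> // w _.
  by rewrite /beyond /= distxx.
exists (fun i => sval (iter i nxt (exist _ v vinf))); split=> // i.
  by rewrite iterS; case: (nxtP (iter i nxt (exist _ v vinf))).
elim: i => [|i IH]; first exact: distxx.
by rewrite iterS; case: (nxtP (iter i nxt (exist _ v vinf))) => _ ->; rewrite IH.
Qed.

End Distance.

Definition deg2 (G : sgraph) (x : G) : Prop :=
  exists a b, a <> b /\ forall w, adj x w = (w == a) || (w == b).

Lemma deg2_nbrs (G : sgraph) (x a b w : G) : deg2 x -> adj x a -> adj x b -> a <> b ->
  adj x w = (w == a) || (w == b).
Proof.
move=> [a' [b' [_ xE]]] xa xb ab; rewrite xE.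
by move: xa xb; rewrite !xE => /orP[]/eqP ea /orP[]/eqP eb; subst; rewrite // orbC.
Qed.

Lemma deg2_automorphism (G : sgraph) (f : G -> G) u :
  automorphism f -> deg2 (f u) -> deg2 u.
Proof.
move=> [[g fK gK] f_adj] [a [b [ab uE]]]; exists (g a), (g b); split.
  by move=> E; apply: ab; rewrite -[a]gK E gK.
by move=> w; rewrite -f_adj uE -!(can2_eq fK gK).
Qed.

Lemma walk_automorphism (G : sgraph) (f : G -> G) n u w :
  automorphism f -> walk n u w -> walk n (f u) (f w).
Proof.
move=> [_ f_adj] [p up [pw pn]]; exists (map f p).
  by rewrite path_map; apply: sub_path up => x y; rewrite /= f_adj.
by rewrite last_map pw size_map.
Qed.

(** An automorphism carrying a class representative u to x carries [z] to a vertex not of degree 2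
    at distance at most dist u z from x. There are finitely many classes, so a maximum of these
    distances serves for all x. *)
Lemma near_not_deg2 (G : sgraph) (z : G) : connected_graph G -> quasi_transitive G ->
  ~ deg2 z -> exists C, forall x : G, exists2 y, ~ deg2 y & exists2 n, (n <= C)%N & walk n x y.
Proof.
move=> Gconn [k [c cP]] nz.
have /choice[C CP] : forall i : 'I_k, exists C, forall x, c x = i ->
    exists2 y : G, ~ deg2 y & exists2 n, (n <= C)%N & walk n x y.
  move=> i; have [[u ui]|none] := pselect (exists u, c u = i); last first.
    by exists 0%N => x xi; case: none; exists x.
  exists (dist Gconn u z) => x xi.
  have [f fA fu] := cP u x (etrans ui (esym xi)).
  exists (f z); first by move=> /(deg2_automorphism fA).
  exists (dist Gconn u z) => //; rewrite -fu.
  exact/walk_automorphism/walk_dist.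
exists (\max_i C i) => x; have [y ny [n nC xy]] := CP _ x erefl.
by exists y => //; exists n => //; apply: leq_trans nC (leq_bigmax _).
Qed.

Section Ray.
Variables (G : sgraph) (Gconn : connected_graph G) (v : G) (p : nat -> G).
Hypothesis p_adj : forall i, adj (p i) (p i.+1).
Hypothesis p_dist : forall i, dist Gconn v (p i) = i.

Lemma ray_inj : injective p.
Proof. by move=> i j ij; rewrite -[i]p_dist ij p_dist. Qed.

Lemma ray_adj_near i j : adj (p i) (p j) -> (i <= j.+1)%N && (j <= i.+1)%N.
Proof.
move=> ij; have := dist_adj Gconn v ij; rewrite adj_sym in ij.
by have := dist_adj Gconn v ij; rewrite !p_dist => -> ->.
Qed.

Lemma ray_prev_next i : p i <> p i.+2.
Proof. by move=> /ray_inj; lia. Qed.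

(** At a vertex of degree 2 inside the ray both neighbours lie on the ray, so a walk can only step
    along it. The condition on [a] provides a predecessor. *)
Lemma ray_walk_deg2 a b n i y : (0 < a)%N ->
  (forall k, (a <= k <= b)%N -> deg2 (p k)) ->
  (a + n <= i)%N -> (i + n <= b)%N -> walk n (p i) y ->
  exists2 j, (a <= j <= b)%N & y = p j.
Proof.
move=> a0 seg; elim: n i => [|n IH] i ai ib [[|x q] //=].
- by move=> _ [<- _]; exists i => //; lia.
- by move=> _ [].
- by move=> _ [_].
case: i ai ib => [|i] ai ib; first by lia.
have di : deg2 (p i.+1) by apply: seg; lia.
rewrite (deg2_nbrs x di (a := p i) (b := p i.+2)) //; last exact: ray_prev_next.
  move=> /andP[xE xq] [qy [qn]].
  by case/orP: xE => /eqP xE; subst x; [apply: (IH i)|apply: (IH i.+2)];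
    try lia; exists q.
by rewrite adj_sym.
Qed.

(** On a geodesic ray, [p i.+1] is adjacent to exactly [p i] and [p i.+2] among the ray vertices; a
    degree other than 2 requires a further neighbour. *)
Lemma ray_side i : ~ deg2 (p i.+1) -> exists2 x, adj (p i.+1) x & forall j, x <> p j.
Proof.
move=> nd; apply: contrapT => /forall2NP none; apply: nd.
exists (p i), (p i.+2); split; first exact: ray_prev_next.
move=> w; apply/idP/idP => [iw|/orP[]/eqP -> //]; last by rewrite adj_sym.
have [//|/existsNP[j /contrapT wj]] := none w.
subst w; have := ray_adj_near iw.
have ji : j <> i.+1 by move=> ji; rewrite ji adj_irrefl in iw.
move=> ij; have [->|->] : j = i \/ j = i.+2 by lia.
  by rewrite eqxx.
by rewrite eqxx orbT.
Qed.

End Ray.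

Lemma comb_exists (G : sgraph) (z v : G) : connected_graph G -> quasi_transitive G ->
  (forall x : G, finite_set [set w | adj x w]) -> infinite_set [set: G] -> ~ deg2 z ->
  exists p N ext L, [/\ @comb G p N ext, p 0%N = v & forall j, (N j <= L * j.+1)%N].
Proof.
move=> Gconn Gqt Gfin Ginf nz.
have [C CP] := near_not_deg2 Gconn Gqt nz.
have [p [p0 p_adj p_dist]] := geodesic_ray Gconn Gfin Ginf v.
have p_inj := ray_inj p_dist.
(* Each block has a window of 2C + 1 vertices, in which a walk of length at most [C] from the centre
   is confined if all degrees are 2. The remaining 3 vertices keep feet of different blocks more
   than two apart. *)
pose L := (2 * C + 4)%N.
have /choice[N NP] : forall j, exists n, (L * j < n <= L * j + 2 * C + 1)%N /\ ~ deg2 (p n).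
  move=> j; apply: contrapT => /forallNP none.
  have [y ny [n nC xy]] := CP (p (L * j + 1 + C)%N).
  have [i ij yi] : exists2 i, (L * j + 1 <= i <= L * j + 2 * C + 1)%N & y = p i.
    apply: (ray_walk_deg2 p_adj p_dist _ _ _ _ xy); [lia| |lia|lia].
    by move=> k kj; apply: contrapT => nk; apply: (none k); split=> //; lia.
  by apply: (none i); split; [lia|rewrite -yi].
have /choice[ext extP] : forall j, exists x, adj (p (N j)) x /\ forall i, x <> p i.
  move=> j; have [] := NP j; case: (N j) => [|i]; first by lia.
  by move=> _ /(ray_side p_adj p_dist)[x ix xp]; exists x.
have N_gap i j : (i < j)%N -> (N i + 3 <= N j)%N.
  move=> ij; have [Ni _] := NP i; have [Nj _] := NP j.
  have : (L * i.+1 <= L * j)%N by rewrite leq_mul2l ij orbT.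
  by rewrite mulnS /L; lia.
(* A common tip would put two feet at distance at most 2. *)
have ext_ne i j : (i < j)%N -> ext i <> ext j.
  move=> ij E; have [ai _] := extP i; have [aj _] := extP j.
  rewrite adj_sym in aj; rewrite -E in aj.
  have := dist_adj Gconn v ai; have := dist_adj Gconn v aj.
  by rewrite !p_dist; have := N_gap i j ij; lia.
exists p, N, ext, L; split=> //.
  split=> //.
  - by move=> i j /N_gap; lia.
  - move=> i j E; have [ij|ji|//] := ltngtP i j.
      by case: (ext_ne i j).
    by case: (ext_ne j i).
  - by move=> i j; case: (extP i).
  - by move=> i; case: (extP i).
by move=> j; have [] := NP j; rewrite mulnS /L; lia.
Qed.

(** * Recognizing the line among graphs with all degrees equal to 2 *)

Section Line.
Variables (G : sgraph) (f : int -> G).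
Hypothesis G2 : forall x : G, deg2 x.
Hypothesis f_adj : forall i, adj (f i) (f (i + 1)).
Hypothesis f_turn : forall i, f (i - 1) <> f (i + 1).
Hypothesis f_inj_nat : forall m n : nat, f m%:Z = f n%:Z -> m = n.

Lemma line_nbrs i x : adj (f i) x = (x == f (i - 1)) || (x == f (i + 1)).
Proof.
apply: deg2_nbrs => //; by rewrite adj_sym -{2}[i](subrK 1).
Qed.

(** Given a repetition f i = f (i + n + 1), the neighbour f (i + n) is f (i + 1) or f (i - 1). The
    former is a shorter repetition, a turn or a loop; the latter makes [f] periodic from i on,
    against injectivity on the naturals. *)
Lemma line_inj_shift n : forall i, f i <> f (i + n.+1%:Z).
Proof.
elim/ltn_ind: n => n IH i E.
have : adj (f i) (f (i + n%:Z)).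
  by rewrite E adj_sym -(_ : i + n%:Z + 1 = i + n.+1%:Z) //; lia.
rewrite line_nbrs => /orP[]/eqP E'; last first.
  case: n => [|[|n]] in IH E E' *.
  - by have := f_adj i; rewrite -E' addr0 adj_irrefl.
  - apply: (f_turn (i := i + 1)).
    by rewrite addrK E; congr f; lia.
  - apply: (IH n _ (i + 1)); first by lia.
    by rewrite -E'; congr f; lia.
have per t : f (i - 1 + t%:Z) = f (i + n%:Z + t%:Z) /\ f (i + t%:Z) = f (i + n.+1%:Z + t%:Z).
  elim: t => [|t [IH1 IH2]]; first by rewrite !addr0.
  split; first by rewrite (_ : i - 1 + t.+1%:Z = i + t%:Z); [rewrite IH2; congr f|]; lia.
  have : adj (f (i + n.+1%:Z + t%:Z)) (f (i + t%:Z + 1)) by rewrite -IH2.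
  rewrite line_nbrs => /orP[]/eqP h; last by rewrite (_ : i + t.+1%:Z = i + t%:Z + 1); [rewrite h; congr f|]; lia.
  case: (@f_turn (i + t%:Z)); rewrite h (_ : i + t%:Z - 1 = i - 1 + t%:Z); last by lia.
  by rewrite IH1; congr f; lia.
(* Shifting by |i| moves both indices into the naturals. *)
have [_] := per (absz i).
have -> : i + (absz i)%:Z = (absz (i + (absz i)%:Z))%:Z by lia.
have -> : i + n.+1%:Z + (absz i)%:Z = (absz (i + n.+1%:Z + (absz i)%:Z))%:Z by lia.
by move=> /f_inj_nat; lia.
Qed.

Lemma line_inj : injective f.
Proof.
have lt_ne i j : i < j -> f i <> f j.
  move=> ij; rewrite (_ : j = i + (absz (j - i)).-1.+1%:Z); last by lia.
  exact: line_inj_shift.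
by move=> i j E; have [/lt_ne|/lt_ne/nesym|] := ltgtP i j.
Qed.

(** The image of [f] is closed under taking neighbours, hence is the whole connected graph. *)
Lemma line_isomorphic : connected_graph G -> isomorphic G int_path.
Proof.
move=> Gconn.
have surj x : exists i, f i = x.
  have [q] := Gconn (f 0) x; elim: q (0 : int) => [|y q IH] i /=.
    by move=> _ <-; exists i.
  by rewrite line_nbrs => /andP[/orP[]/eqP -> yq]; apply: IH yq.
have /choice[h hK] := surj.
have fK : cancel f h by move=> i; apply: line_inj; rewrite hK.
exists h; split; first by exists f.
move=> x y; rewrite -[in RHS](hK x) -[in RHS](hK y) line_nbrs !(inj_eq line_inj).
by rewrite /adj /= /int_adj orbC; congr (_ || _); apply/eqP/eqP; lia.
Qed.

End Line.

(** A geodesic ray, known to be injective, gives the nonnegative half; the negative half leaves each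
    vertex through the neighbour it did not come from. *)
Lemma deg2_int_path (G : sgraph) : connected_graph G ->
  (forall x : G, finite_set [set w | adj x w]) -> infinite_set [set: G] ->
  (forall x : G, deg2 x) -> isomorphic G int_path.
Proof.
move=> Gconn Gfin Ginf G2.
have [v _] : exists v : G, True.
  by apply: contrapT => none; apply: Ginf; rewrite (_ : setT = set0) //;
    apply/seteqP; split=> // x _; apply: none; exists x.
have [p [p0 p_adj p_dist]] := geodesic_ray Gconn Gfin Ginf v.
have p_inj := ray_inj p_dist.
have /choice[other otherP] : forall xa : G * G, exists b,
    adj xa.1 xa.2 -> adj xa.1 b /\ b <> xa.2.
  move=> [x a] /=; have [b [c [bc xE]]] := G2 x.
  have [ab|ab] := eqVneq a b.
    by exists c => _; rewrite xE eqxx orbT ab; split=> // /esym.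
  by exists b => _; rewrite xE eqxx; split=> //; apply/eqP; rewrite eq_sym.
(* The state is the current vertex with the one before it; starting from (p 0, p 1) makes the walk
   leave the ray backwards. *)
pose st n := iter n (fun xa : G * G => (other xa, xa.1)) (p 0%N, p 1%N).
pose l n := (st n).1.
have st_adj n : adj (st n).1 (st n).2.
  elim: n => [|n IH]; first exact: p_adj.
  by rewrite adj_sym; case: (otherP _ IH).
have l_adj n : adj (l n) (l n.+1) by case: (otherP _ (st_adj n)).
have l_turn n : l n.+2 <> l n by case: (otherP _ (st_adj n.+1)).
have l1 : l 1%N <> p 1%N by case: (otherP _ (st_adj 0%N)).
pose f (i : int) := if (0 <= i) then p (absz i) else l (absz i).
have fp n : f n%:Z = p n by [].
have fn n : f (- n%:Z) = l n by case: n => //= n; rewrite /f oppr0.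
apply: (@line_isomorphic G f) => //.
- case=> n; first by rewrite (_ : Posz n + 1 = n.+1%:Z) ?fp //; lia.
  rewrite NegzE (_ : - n.+1%:Z + 1 = - n%:Z); last by lia.
  by rewrite !fn adj_sym.
- case=> [[|n]|n].
  + by rewrite sub0r add0r (fn 1%N) (fp 1%N).
  + rewrite (_ : n.+1%:Z - 1 = n%:Z); last by lia.
    rewrite (_ : n.+1%:Z + 1 = n.+2%:Z); last by lia.
    by rewrite !fp; exact: (ray_prev_next p_dist).
  + rewrite NegzE (_ : - n.+1%:Z - 1 = - n.+2%:Z); last by lia.
    rewrite (_ : - n.+1%:Z + 1 = - n%:Z); last by lia.
    by rewrite !fn; apply: l_turn.
Qed.

(** * Products of independent variables *)

Section IndependentMarkov.
Context {R : realType} {d : measure_display} {T : measurableType d}.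
Variables (P : probability T R) (I : choiceType) (X : I -> {RV P >-> R}).
Hypothesis X_indep : mutually_independent X.
Variables (C : finType) (D : C -> set R) (q : C -> R).
Hypothesis D_meas : forall c, measurable (D c).
Hypothesis D_prob : forall i c, P (X i @^-1` D c) = (q c)%:E.
Variables (phi : nat -> I) (f : nat -> C -> R) (g : nat -> R -> R).
Hypothesis phi_inj : injective phi.
Hypothesis f_gt0 : forall i c, 0 < f i c.
Hypothesis g_ge0 : forall i x, 0 <= g i x.
Hypothesis g_le : forall i c x, D c x -> g i x <= f i c.

Lemma bigcap_fset_measurable (J : {fset I}) (W : I -> set R) :
  (forall i, i \in J -> measurable (W i)) ->
  measurable (\bigcap_(i in [set` J]) (X i @^-1` W i)).
Proof.
move=> mW; apply: fin_bigcap_measurable => // i /= iJ.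
by rewrite -[X in measurable X]setTI; apply: measurable_funP => //; exact: mW.
Qed.

(* Markov's inequality for the product of the g's, by conditioning on the
   variables one at a time.  The event itself need not be measurable. *)
Lemma indep_markov (K : seq nat) (J : {fset I}) (W : I -> set R) (r theta : R) :
  uniq K -> (forall k, k \in K -> phi k \notin J) ->
  (forall i, i \in J -> measurable (W i)) ->
  (\prod_(i <- J) P (X i @^-1` W i))%E = r%:E -> 0 < theta ->
  exists B, [/\ measurable B,
    [set w | [/\ forall i, i \in J -> W i (X i w),
      forall k, k \in K -> exists c, D c (X (phi k) w)
      & theta <= \prod_(k <- K) g k (X (phi k) w)]] `<=` B
    & (P B <= (r * (theta^-1 * \prod_(k <- K) \sum_c q c * f k c))%:E)%E].
Proof.
elim: K J W r theta => [|k K IH] J W r theta /=.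
  move=> _ _ mW rE theta0; have mB := bigcap_fset_measurable mW.
  have [theta1|theta1] := leP theta 1.
    exists (\bigcap_(i in [set` J]) (X i @^-1` W i)); split=> //.
      by move=> w [Ww _ _] i /= /Ww.
    rewrite X_indep // rE lee_fin big_nil mulr1 ler_peMr ?invf_ge1 //.
    by rewrite -lee_fin -rE; apply: prode_ge0.
  exists set0; split=> //; first by move=> w [_ _]; rewrite big_nil leNgt theta1.
  rewrite measure0 lee_fin big_nil mulr1 mulr_ge0 ?invr_ge0 ?(ltW theta0) //.
  by rewrite -lee_fin -rE; apply: prode_ge0.
move=> /andP[kK uK] KJ mW rE theta0.
have kJ : phi k \notin J by apply: KJ; rewrite inE eqxx.
pose W' c i := if i == phi k then D c else W i.
(* Where [X (phi k)] lies in [D c], the factor [g k] is at most [f k c], so the remaining product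
   must reach [theta / f k c]. *)
have /choice[B BP] : forall c, exists B, [/\ measurable B,
    [set w | [/\ forall i, i \in (phi k |` J)%fset -> W' c i (X i w),
      forall k, k \in K -> exists c, D c (X (phi k) w)
      & theta / f k c <= \prod_(k <- K) g k (X (phi k) w)]] `<=` B
    & (P B <= ((q c * r) * ((theta / f k c)^-1 * \prod_(k <- K) \sum_c q c * f k c))%:E)%E].
  move=> c; apply: IH => //.
  - move=> l lK; rewrite in_fset1U negb_or KJ ?inE ?lK ?orbT // andbT.
    by apply: contra kK => /eqP/phi_inj <-.
  - move=> i; rewrite in_fset1U /W'; case: eqP => //= _; exact: mW.
  - rewrite big_fsetU1 //= EFinM -rE /W' eqxx D_prob; congr (_ * _)%E.
    rewrite big_seq [RHS]big_seq; apply: eq_bigr => i iJ.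
    by case: eqP => // ik; rewrite -ik iJ in kJ.
  - by rewrite divr_gt0.
exists (\big[setU/set0]_(c : C) B c); split.
- by apply: bigsetU_measurable => c _; case: (BP c).
- move=> w [wJ wK th].
  have [|c wc] := wK k; first by rewrite inE eqxx.
  rewrite -bigcup_seq; exists c => /=; first by rewrite mem_index_enum.
  have [_ sB _] := BP c; apply: sB; split.
  + move=> i; rewrite in_fset1U /W'; case: eqP => [->//|_ /=]; exact: wJ.
  + by move=> l lK; apply: wK; rewrite inE lK orbT.
  + rewrite ler_pdivrMr // mulrC; apply: le_trans th _.
    by rewrite big_cons ler_wpM2r ?prodr_ge0 // => *; exact: g_le.
- apply: (@le_trans _ _ (\sum_c P (B c))%E).
    elim: (index_enum C) => [|c s IHs]; first by rewrite !big_nil measure0.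
    rewrite !big_cons; apply: (le_trans (measureU2 _ _ _)).
    + by case: (BP c).
    + by apply: bigsetU_measurable => c' _; case: (BP c').
    + by rewrite leeD2l.
  apply: (@le_trans _ _ (\sum_c ((q c * r) *
    ((theta / f k c)^-1 * \prod_(k <- K) \sum_c q c * f k c))%:E)%E).
    by apply: lee_sum => c _; case: (BP c).
  rewrite sumEFin lee_fin big_cons; set Q := \prod_(_ <- K) _.
  rewrite (eq_bigr (fun c => q c * f k c * (r * (theta^-1 * Q)))); last first.
    by move=> c _; rewrite invf_div; ring.
  by rewrite -mulr_suml le_eqVlt; apply/orP; left; apply/eqP; ring.
Qed.

End IndependentMarkov.

(** With H the sum of the previous terms x, (1 - x)(1 + H + x) <= 1 + H. So the product is at most
    the inverse of 1 + [b] times a harmonic sum, and the harmonic series diverges. *)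
Lemma prod_harmonic_small (R : realType) (b eps : R) : 0 < b <= 1 -> 0 < eps ->
  exists J, \prod_(0 <= j < J) (1 - b / j.+1%:R) <= eps.
Proof.
move=> /andP[b0 b1] eps0.
have prod_le J : \prod_(0 <= j < J) (1 - b / j.+1%:R) * (1 + b * series harmonic J) <= 1.
  elim: J => [|J IH].
    by rewrite big_geq // /series /= big_geq // mulr0 addr0 mulr1.
  rewrite big_nat_recr //= seriesSr [b * (_ + _)]mulrDr [1 + (_ + _)]addrA.
  rewrite -[harmonic J]/(J.+1%:R^-1).
  set x := b / _; set H := b * series _ _ in IH *.
  have x0 : 0 <= x by rewrite divr_ge0 // ltW.
  have x1 : x <= 1 by rewrite ler_pdivrMr ?mul1r ?ltr0n // (le_trans b1) // ler1n.
  have p0 : 0 <= \prod_(0 <= i < J) (1 - b / i.+1%:R).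
    apply: prodr_ge0 => i _; rewrite subr_ge0 ler_pdivrMr ?mul1r ?ltr0n //.
    by rewrite (le_trans b1) // ler1n.
  have H0 : 0 <= H.
    apply: mulr_ge0; first exact: ltW.
    by apply: sumr_ge0 => i _; exact: harmonic_ge0.
  apply: le_trans IH; rewrite -mulrA ler_wpM2l //.
  by nra.
have : (series harmonic n : R) @[n --> \oo] --> +oo.
  apply: nondecreasing_dvgn_lt; last exact: dvg_harmonic.
  by apply: nondecreasing_series => i _ _; exact: harmonic_ge0.
move=> /cvgryPge/(_ (eps^-1 / b))[J _ JP]; exists J.
have {}JP := JP J (leqnn _).
have H0 : 0 < 1 + b * series harmonic J.
  have : 0 <= eps^-1 / b by rewrite divr_ge0 ?invr_ge0 // ltW.
  by rewrite /= in JP; nra.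
have := prod_le J; rewrite -ler_pdivlMr // mul1r => /le_trans; apply.
rewrite invf_ple ?posrE // -[leLHS](divfK (lt0r_neq0 b0)).
by rewrite /= in JP; rewrite mulrC; nra.
Qed.

(** * Bounds on the supremum and on uniform initial levels *)

Lemma do_moves_range (R : realType) (G : sgraph) (eta : G -> R) s :
  (forall u, 0 <= eta u <= 1) -> all (@legal_move R G) s ->
  forall u, 0 <= do_moves eta s u <= 1.
Proof.
elim: s eta => [//|[x y mu] s IH] eta eta01 /= /andP[/and3P[_ /= mu0 mu1] ls].
apply: IH => // u; have := eta01 x; have := eta01 y; have := eta01 u.
by case: ifP => _; [|case: ifP => _]; move=> /andP[? ?] /andP[? ?] /andP[? ?];
  apply/andP; split; nra.
Qed.

Section Kappa.
Variables (R : realType) (G : sgraph) (eta : G -> R) (v : G).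
Hypothesis eta01 : forall u, 0 <= eta u <= 1.

Lemma achievable_has_ubound : has_ubound (achievable eta v).
Proof.
exists 1 => _ [_ [s ls <-]].
by case/andP: (do_moves_range eta01 ls v).
Qed.

Lemma kappa_ge s : all (@legal_move R G) s -> do_moves eta s v <= kappa eta v.
Proof.
move=> ls; apply: (ub_le_sup achievable_has_ubound).
by split; [case/andP: (do_moves_range eta01 ls v)|exists s].
Qed.

Lemma kappa_le c : (forall s, all (@legal_move R G) s -> do_moves eta s v <= c) ->
  kappa eta v <= c.
Proof.
move=> le_c; apply: ge_sup; last by move=> _ [_ [s ls <-]]; exact: le_c.
by exists (eta v); split; [case/andP: (eta01 v)|exists [::]].
Qed.

Lemma kappa_le1 : kappa eta v <= 1.
Proof. by apply: kappa_le => s ls; case/andP: (do_moves_range eta01 ls v). Qed.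

End Kappa.

Section Uniform.
Context {R : realType} {d : measure_display} {T : measurableType d}.
Variable P : probability T R.

Lemma uniform01_itv (X : {RV P >-> R}) (a b : R) : uniform01 X ->
  0 <= a -> a <= b -> b <= 1 -> P (X @^-1` `[a, b[) = (b - a)%:E.
Proof.
move=> X_unif a0 ab b1.
have := X_unif `[a, b[%classic (measurable_itv _); rewrite /distribution /pushforward /= => ->.
rewrite /uniform_prob integral_uniform_pdf.
rewrite (_ : _ `&` _ = `[a, b[%classic); last first.
  apply/seteqP; split=> x /=; rewrite !in_itv /=; first by case.
  by move=> /andP[ax xb]; rewrite ax xb; split=> //; apply/andP; split; lra.
rewrite (eq_integral (cst 1%E)); last first.
  move=> x; rewrite inE /= in_itv /= => /andP[ax xb]; rewrite /uniform_pdf subr0 invr1.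
  by rewrite ifT //; apply/andP; split; lra.
rewrite integral_cst /=; last exact: measurable_itv.
rewrite mul1e lebesgue_measure_itv /= lte_fin.
case: ltP => [//|ba]; have -> : a = b by apply/eqP; rewrite eq_le ab.
by rewrite subrr.
Qed.

(** Countability allows uniting the null sets of all vertices. The range is half-open to match the
    half-open classes into which levels are sorted. *)
Lemma negligible_range (G : choiceType) (X : G -> {RV P >-> R}) :
  countable [set: G] -> (forall u, uniform01 (X u)) ->
  P.-negligible [set w | ~ forall u, 0 <= X u w < 1].
Proof.
move=> /countable_injP[h h_inj] X_unif.
pose F n := [set w | exists u, h u = n /\ ~ (0 <= X u w < 1)].
apply: (@negligibleS _ _ _ _ (\bigcup_n F n)).
  by move=> w /= /existsNP[u uw]; exists (h u) => //; exists u.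
apply: negligible_bigcup => n.
have [[u un]|none] := pselect (exists u, h u = n); last first.
  rewrite (_ : F n = set0); first exact: negligible_set0.
  by apply/seteqP; split=> // w [u [un _]]; case: none; exists u.
have mA : measurable (X u @^-1` `[0, 1[%classic).
  rewrite -[X in measurable X]setTI; apply: measurable_funP => //.
exists (X u @^-1` (~` `[0, 1[%classic)); rewrite preimage_setC; split.
- exact: measurableC.
- apply: etrans (probability_setC P mA) _.
  by rewrite uniform01_itv // subr0 subee.
- move=> w [u' [u'n u'w]]; have -> : u = u' by apply: h_inj; rewrite ?inE // un u'n.
  by rewrite /= in_itv /=.
Qed.

End Uniform.

(** * Almost sure approach to level 1 along a comb *)

Section Comb.
Context {R : realType} {d : measure_display} {T : measurableType d}.
Variables (P : probability T R) (G : sgraph) (eta : G -> {RV P >-> R}).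
Hypothesis eta_iid : iid_uniform01 eta.
Variables (p : nat -> G) (N : nat -> nat) (ext : nat -> G) (L : nat).
Hypothesis pNext : comb p N ext.
Hypothesis N_le : forall j, (N j <= L * j.+1)%N.

(** A tip reaches [h] with probability 1 - h, so the mean factor of tooth j is 1 - (1 - h) / (N j +
    2), where N j + 2 <= (L + 2)(j + 1). Markov's inequality for the product gives the bound. *)
Lemma comb_defect_event (h theta : R) J : 0 < h < 1 -> 0 < theta ->
  exists B, [/\ measurable B,
    [set w | (forall u, 0 <= eta u w < 1) /\
      theta <= \prod_(i < J) tooth_factor N h i (eta (ext i) w)] `<=` B
    & (P B <= (theta^-1 * \prod_(0 <= j < J) (1 - (1 - h) / L.+2%:R / j.+1%:R))%:E)%E].
Proof.
move=> /andP[h0 h1] theta0; have [eta_indep eta_unif] := eta_iid.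
pose D (c : bool) : set R := if c then `[h, 1[%classic else `[0, h[%classic.
pose q (c : bool) : R := if c then 1 - h else h.
pose f j (c : bool) : R := if c then 1 - (N j).+2%:R^-1 else 1.
have D_meas c : measurable (D c) by case: c; exact: measurable_itv.
have D_prob i c : P (eta i @^-1` D c) = (q c)%:E.
  by case: c; rewrite uniform01_itv ?subr0 // ltW.
have f_gt0 i c : 0 < f i c.
  by case: c => //=; rewrite subr_gt0 invf_lt1 ?ltr0n // ltr1n.
have g_le i c x : D c x -> tooth_factor N h i x <= f i c.
  rewrite /tooth_factor; case: c => /=; rewrite in_itv /= => /andP[xh hx].
    by rewrite xh.
  by rewrite [h <= x]leNgt hx.
have [B [mB sB PB]] := indep_markov eta_indep D_meas D_prob (tip_inj pNext) f_gt0
  (tooth_factor_ge0 N h) g_le (iota_uniq 0 J) (J := fset0)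
  (W := fun=> setT) (fun _ _ => isT) (fun _ _ => measurableT) (big_seq_fset0 _ _) theta0.
exists B; split=> //.
  move=> w [w01 wth]; apply: sB; split=> //.
    move=> k _; have /andP[k0 k1] := w01 (ext k).
    have [hk|kh] := leP h (eta (ext k) w).
      by exists true; rewrite /= in_itv /= hk.
    by exists false; rewrite /= in_itv /= k0.
  by apply: le_trans wth _; rewrite -(big_mkord predT (fun i => tooth_factor N h i (eta (ext i) w))) /index_iota subn0.
apply: le_trans PB _; rewrite lee_fin mul1r ler_wpM2l ?invr_ge0 ?(ltW theta0) //.
rewrite /index_iota subn0; apply: ler_prod => j _; rewrite big_bool /= mulr1.
have Nj : (N j).+2%:R <= L.+2%:R * j.+1%:R :> R.
  rewrite -natrM ler_nat; have := N_le j; lia.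
have n0 : 0 < (N j).+2%:R :> R by rewrite ltr0n.
have n1 : 0 < L.+2%:R * j.+1%:R :> R by rewrite mulr_gt0 // ltr0n.
have -> : (1 - h) * (1 - (N j).+2%:R^-1) + h = 1 - (1 - h) * (N j).+2%:R^-1 by ring.
apply/andP; split.
  rewrite subr_ge0 ler_pdivrMr // mul1r.
  have : 1 <= (N j).+2%:R :> R by rewrite ler1n.
  by lra.
rewrite lerB // -mulrA -invfM ler_wpM2l //; first by lra.
by rewrite lef_pV2 // posrE.
Qed.

(** If the supremum is below 1, it is below h^2 for some [h] among countably many. Then no product
    of tooth factors can fall below 1 - h, which is a null event by the harmonic product. *)
Lemma comb_kappa_eq1 : countable [set: G] ->
  P.-negligible [set w | kappa (fun u => eta u w) (p 0%N) <> 1].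
Proof.
move=> Gcount; have [eta_indep eta_unif] := eta_iid.
pose h n : R := 1 - n.+2%:R^-1.
have h01 n : 0 < h n < 1.
  rewrite /h subr_gt0 invf_lt1 ?ltr0n // ltr1n /=.
  by rewrite ltrBlDr ltrDl invr_gt0 ltr0n.
pose E n := [set w | (forall u, 0 <= eta u w < 1) /\
   forall J, 1 - h n <= \prod_(i < J) tooth_factor N (h n) i (eta (ext i) w)].
apply: (@negligibleS _ _ _ _
  ([set w | ~ forall u, 0 <= eta u w < 1] `|` \bigcup_n E n)).
  move=> w /= kw; have [w01|] := pselect (forall u, 0 <= eta u w < 1); last by left.
  right.
  have w01' u : 0 <= eta u w <= 1 by case/andP: (w01 u) => -> /ltW.
  have k1 : kappa (fun u => eta u w) (p 0%N) < 1.
    by rewrite lt_neqAle kappa_le1 // andbT; apply/eqP.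
  set kap := kappa _ _ in kw k1 *.
  (* This makes 1 / (n + 2) less than half of 1 - kap, hence h^2 >= 1 - 2 / (n + 2) > kap. *)
  pose n := Num.truncn (2 / (1 - kap)).
  have hn : kap < h n * h n.
    have n_gt : 2 / (1 - kap) < n.+2%:R.
      apply: lt_trans (_ : n.+1%:R < _); last by rewrite ltr_nat.
      by have := truncnS_gt (2 / (1 - kap)).
    have k1' : 0 < 1 - kap by lra.
    rewrite ltr_pdivrMr // mulrC -ltr_pdivrMr ?ltr0n // in n_gt.
    have : 0 < n.+2%:R^-1 :> R by rewrite invr_gt0 ltr0n.
    rewrite /h; move: (n.+2%:R^-1) n_gt => i n_gt i0; nra.
  exists n => //; split=> // J; rewrite leNgt; apply/negP => lt.
  have /andP[h0 h1] := h01 n.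
  set W := \prod_(_ < _) _ in lt.
  have : h n * h n < h n * (1 - W) by rewrite ltr_pM2l //; lra.
  rewrite -subr_gt0; set dlt := _ - _ => dlt0.
  have [s ls] := comb_level_ge J pNext (fun u => proj1 (andP (w01' u))) (ltW h0) dlt0.
  rewrite -/W => s_ge; have := kappa_ge (p 0%N) w01' ls.
  by move: s_ge; rewrite -/kap /dlt; lra.
apply: negligibleU; first exact: negligible_range.
apply: negligible_bigcup => n.
have /andP[h0 h1] := h01 n.
have th0 : 0 < 1 - h n by lra.
have /choice[B BP] := fun J => comb_defect_event J (h01 n) th0.
have mB : measurable (\bigcap_J B J).
  by apply: bigcap_measurableType => J _; case: (BP J).
exists (\bigcap_J B J); split=> //; last first.
  by move=> w [w01 wJ] J _; have [_ sB _] := BP J; apply: sB; split.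
apply/eqP; rewrite eq_le measure_ge0 andbT; apply/lee_addgt0Pr => e e0.
rewrite add0e.
have b01 : 0 < (1 - h n) / L.+2%:R <= 1.
  rewrite divr_gt0 ?ltr0n //= ler_pdivrMr ?ltr0n // mul1r.
  have : 1 <= L.+2%:R :> R by rewrite ler1n.
  by lra.
have [J JP] := prod_harmonic_small b01 (mulr_gt0 th0 e0).
have [mBJ _ PBJ] := BP J.
apply: (@le_trans _ _ (P (B J))).
  by apply: le_measure; rewrite ?inE // => w; apply.
apply: le_trans PBJ _; rewrite lee_fin ler_pdivrMl //.
Qed.

End Comb.

(** * Chernoff bounds for sums of uniform levels *)

(** The Chernoff factor per term at base 21/20: ten times a level, rounded up, is uniform on 1, ..,
    10, and the slope 3/5 becomes the threshold 6. *)
Definition mgf_bound (R : realType) : R :=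
  (\sum_(c < 10) 10^-1 * (21/20) ^+ c.+1) / (21/20) ^+ 6.

Lemma mgf_bound_lt1 (R : realType) : 0 < mgf_bound R < 1.
Proof.
rewrite /mgf_bound ltr_pdivrMr ?exprn_gt0 // mul1r divr_gt0 ?exprn_gt0 //.
  by rewrite !big_ord_recr big_ord0 /=; lra.
by rewrite !big_ord_recr big_ord0 /=; lra.
Qed.

Section LargeDeviation.
Context {R : realType} {d : measure_display} {T : measurableType d}.
Variables (P : probability T R) (I : choiceType) (X : I -> {RV P >-> R}).
Hypothesis X_iid : iid_uniform01 X.

(** Of length 1/10 and centred at the mean; a level in it, or its mirror image, is at least 1/20
    below the critical slope 3/5. *)
Definition window : set R := `[9/20, 11/20[%classic.

Lemma window_prob (J : {fset I}) :
  (\prod_(i <- J) P (X i @^-1` window))%E = (10^-1 ^+ #|` J|)%:E.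
Proof.
have [_ X_unif] := X_iid.
rewrite (eq_bigr (fun=> (10^-1)%:E)); last first.
  move=> i _; rewrite (_ : 10^-1 = 11/20 - 9/20); last by lra.
  by apply: uniform01_itv => //; lra.
by rewrite prodEFin big_const_seq count_predT iter_mulr_1.
Qed.

(* Chernoff's bound for the sum of the terms outside of the window, rounded up
   to tenths; mirror replaces x by 1 - x, which turns lower into upper
   deviations. *)
Lemma large_deviation (phi : nat -> I) (mirror : bool) (J : {fset I}) M m :
  injective phi -> (forall i, (i < M.*2)%N -> phi i \in J) ->
  (forall i, (M.*2 <= i)%N -> phi i \notin J) ->
  let y x : R := if mirror then 1 - x else x in
  exists B, [/\ measurable B,
    [set w | [/\ forall i, 0 <= X i w < 1, forall i, i \in J -> window (X i w)
      & 3/5 * (M.*2 + m)%:R < \sum_(i < M.*2 + m) y (X (phi i) w)]] `<=` B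
    & (P B <= (10^-1 ^+ #|` J| * (20/21) ^+ M * mgf_bound R ^+ m)%:E)%E].
Proof.
move=> phi_inj phiJ phiJC y; have [X_indep X_unif] := X_iid.
pose b : R := 21/20.
have b1 : 1 < b by rewrite /b; lra.
have b0 : 0 < b by lra.
have expb k : expR (ln b * k%:R) = b ^+ k by rewrite mulrC expRM_natl lnK.
have lnb0 : 0 < ln b by rewrite ln_gt0.
pose D (c : 'I_10) : set R := `[(nat_of_ord c)%:R / 10, (nat_of_ord c).+1%:R / 10[%classic.
pose q (c : 'I_10) : R := 10^-1.
pose f (_ : nat) (c : 'I_10) : R := b ^+ (if mirror then 10 - c else c.+1)%N.
pose g (_ : nat) (x : R) := expR (ln b * (10 * y x)).
have c10 (c : 'I_10) : (nat_of_ord c).+1%:R <= 10 :> R by rewrite ler_nat.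
have cS (c : 'I_10) : (nat_of_ord c).+1%:R = (nat_of_ord c)%:R + 1 :> R by rewrite natr1.
have D_meas c : measurable (D c) by exact: measurable_itv.
have D_prob i c : P (X i @^-1` D c) = (q c)%:E.
  have := c10 c; rewrite cS; have : 0 <= (nat_of_ord c)%:R :> R by [].
  rewrite /D cS => ? ?.
  have -> : q c = ((nat_of_ord c)%:R + 1) / 10 - (nat_of_ord c)%:R / 10 by rewrite /q; lra.
  by apply: uniform01_itv => //; lra.
have f_gt0 i c : 0 < f i c by rewrite exprn_gt0.
have g_ge0 i x : 0 <= g i x by rewrite expR_ge0.
have g_le i c x : D c x -> g i x <= f i c.
  rewrite /D /= in_itv /= cS => /andP[cx xc].
  rewrite /g /f -expb ler_expR ler_pM2l // /y; case: ifP => _; last by rewrite cS; lra.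
  by rewrite natrB ?(ltnW (ltn_ord c)) //; lra.
have mW i : i \in J -> measurable window by move=> _; exact: measurable_itv.
(* The 2M prescribed terms leave a slack of 2M / 20, so the other [m] terms must exceed 3m/5 + M/10;
   this is scaled by 10. *)
pose theta := b ^+ (6 * m + M).
have theta0 : 0 < theta by rewrite exprn_gt0.
have KJ k : k \in iota M.*2 m -> phi k \notin J by rewrite mem_iota => /andP[/phiJC].
have [B [mB sB PB]] := indep_markov X_indep D_meas D_prob phi_inj f_gt0
  g_ge0 g_le (iota_uniq M.*2 m) KJ mW (window_prob J) theta0.
exists B; split=> //.
  move=> w [w01 wJ wsum]; apply: sB; split=> //.
    move=> k _; have /andP[x0 x1] := w01 (phi k).
    set x := X _ w in x0 x1 *.
    have x10 : 0 <= x * 10 by rewrite mulr_ge0.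
    have t10 : (Num.truncn (x * 10) < 10)%N by rewrite truncn_lt_nat //; lra.
    exists (Ordinal t10); rewrite /D /= in_itv /=.
    by have /andP[] := truncn_itv x10; lra.
  rewrite -expR_sum /theta -expb ler_expR -mulr_sumr ler_pM2l // -mulr_sumr.
  move: wsum; rewrite -(big_mkord predT (fun i => y (X (phi i) w))).
  rewrite (@big_cat_nat _ _ _ M.*2) ?leq_addr //= /index_iota addKn subn0.
  have : \sum_(i <- iota 0 M.*2) y (X (phi i) w) <= 11/20 * M.*2%:R.
    rewrite -[M.*2 in leRHS](size_iota 0) -sum1_size natr_sum mulr_sumr.
    rewrite big_seq [leRHS]big_seq; apply: ler_sum => i; rewrite mem_iota mulr1.
    move=> /andP[_ /phiJ/wJ]; rewrite /window /= in_itv /= /y.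
    by case: ifP => _ /andP[]; lra.
  have -> : (6 * m + M)%:R = 6 * m%:R + M%:R :> R by rewrite natrD natrM.
  have -> : (M.*2 + m)%:R = M.*2%:R + m%:R :> R by rewrite natrD.
  have -> : M.*2%:R = 2 * M%:R :> R by rewrite -mul2n natrM.
  by lra.
apply: le_trans PB _; rewrite lee_fin -mulrA ler_wpM2l ?exprn_ge0 //.
have qf k : \sum_c q c * f k c = \sum_(c < 10) 10^-1 * b ^+ c.+1.
  rewrite /q /f; case: (mirror) => //.
  by rewrite (reindex_inj rev_ord_inj) /=; apply: eq_bigr => c _; rewrite subKn.
rewrite (eq_bigr (fun=> \sum_(c < 10) 10^-1 * b ^+ c.+1)); last by move=> k _; rewrite qf.
rewrite big_const_seq count_predT size_iota iter_mulr_1 (_ : 20/21 = b^-1); last first.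
  by rewrite /b; field.
rewrite /mgf_bound -/b expr_div_n /theta exprD exprM invfM exprVn.
by rewrite le_eqVlt; apply/orP; left; apply/eqP; ring.
Qed.

End LargeDeviation.

Lemma geometric_bigcup_le (R : realType) (d : measure_display) (T : measurableType d)
    (P : probability T R) (B : nat -> set T) (a rho : R) :
  0 <= a -> 0 < rho < 1 -> (forall m, measurable (B m)) ->
  (forall m, (P (B m) <= (a * rho ^+ m)%:E)%E) ->
  (P (\bigcup_m B m) <= (a / (1 - rho))%:E)%E.
Proof.
move=> a0 /andP[rho0 rho1] mB PB.
apply: le_trans (le_mu_bigcup P mB _) _; first exact: bigcup_measurable.
apply: lime_le; first by apply: is_cvg_nneseries => *; exact: measure_ge0.
near=> n.
apply: (@le_trans _ _ (\sum_(0 <= i < n) (a * rho ^+ i)%:E)%E).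
  by apply: lee_sum => i _; exact: PB.
rewrite sumEFin lee_fin -mulr_sumr ler_wpM2l // -[leRHS]div1r ler_pdivlMr ?subr_gt0 //.
rewrite big_mkord -[X in _ * X <= _]opprB mulrN mulrC -subrX1 opprB.
by rewrite lerBlDr lerDl exprn_ge0 // ltW.
Unshelve. all: by end_near.
Qed.

(** The window lies between the two slopes, which settles the first [n0] partial sums; further out,
    the upper bound for the mirrored terms is the lower bound. *)
Lemma window_cone (R : realType) (a : nat -> R) n0 :
  (forall i, (i < n0)%N -> window (a i)) ->
  (forall m, \sum_(i < n0 + m) a i <= 3/5 * (n0 + m)%:R) ->
  (forall m, \sum_(i < n0 + m) (1 - a i) <= 3/5 * (n0 + m)%:R) ->
  in_cone a.
Proof.
move=> aw up down n; have [n0n|nn0] := leqP n0 n.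
  have := up (n - n0)%N; have := down (n - n0)%N; rewrite subnKC //.
  by rewrite big_split /= sumrN sumr_const card_ord; lra.
elim: n nn0 => [|n IH] nn0; first by rewrite big_ord0 !mulr0 lexx.
rewrite big_ord_recr /= -natr1.
have := aw n (ltnW nn0); have := IH (ltnW nn0); rewrite /window /= in_itv /=.
by move=> /andP[? ?] /andP[? ?]; apply/andP; split; lra.
Qed.

(** * Failure of determinism on the line *)

Section LineKappa.
Context {R : realType} {d : measure_display} {T : measurableType d}.
Variables (P : probability T R) (G : sgraph) (eta : G -> {RV P >-> R}).
Hypothesis eta_iid : iid_uniform01 eta.

(** The bad set bundles the deviations for all [m]. Its bound carries the probability of the windows
    on [J] as a factor, so for large [M] it is small relative to that event. *)
Lemma deviation_cover (phi : nat -> G) (mirror : bool) (J : {fset G}) M :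
  injective phi -> (forall i, (i < M.*2)%N -> phi i \in J) ->
  (forall i, (M.*2 <= i)%N -> phi i \notin J) ->
  let y x : R := if mirror then 1 - x else x in
  exists B, [/\ measurable B,
    forall w, (forall i, 0 <= eta i w < 1) -> (forall i, i \in J -> window (eta i w)) ->
      ~ B w -> forall m, \sum_(i < M.*2 + m) y (eta (phi i) w) <= 3/5 * (M.*2 + m)%:R
    & (P B <= (10^-1 ^+ #|` J| * (20/21) ^+ M / (1 - mgf_bound R))%:E)%E].
Proof.
move=> phi_inj phiJ phiJC y.
have /choice[B BP] := fun m => large_deviation eta_iid mirror m phi_inj phiJ phiJC.
exists (\bigcup_m B m); split.
- by apply: bigcup_measurable => m _; case: (BP m).
- move=> w w01 wJ nB m; rewrite leNgt; apply/negP => lt; apply: nB.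
  by exists m => //; have [_ sB _] := BP m; apply: sB.
- apply: geometric_bigcup_le (mgf_bound_lt1 R) _ _.
  + by rewrite mulr_ge0 // exprn_ge0 //; lra.
  + by move=> m; case: (BP m).
  + by move=> m; case: (BP m).
Qed.

Variables (g : int -> G) (f : G -> int).
Hypothesis fK : cancel f g.
Hypothesis gK : cancel g f.
Hypothesis gadj : forall i j, adj (g i) (g j) = int_adj i j.

Lemma line_not_deterministic :
  ~ deterministic P (fun w => kappa (fun u => eta u w) (g 0)).
Proof.
move=> [c [Z1 [mZ1 PZ1 Z1P]]]; have [eta_indep eta_unif] := eta_iid.
have Gcount : countable [set: G].
  apply/countable_injP; exists (choice.pickle \o f) => x y _ _ /= E.
  by apply: (can_inj fK); apply: (pcan_inj choice.pickleK).
have [Z2 [mZ2 PZ2 Z2P]] := negligible_range Gcount eta_unif.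
have good w : ~ Z1 w -> ~ Z2 w ->
    kappa (fun u => eta u w) (g 0) = c /\ forall u, 0 <= eta u w < 1.
  move=> n1 n2; split; first by apply: contrapT => h; apply: n1; exact: Z1P.
  by apply: contrapT => h; apply: n2; exact: Z2P.
have le01 w : (forall u, 0 <= eta u w < 1) -> forall u, 0 <= eta u w <= 1.
  by move=> w01 u; case/andP: (w01 u) => -> /ltW.
(* An event more probable than B has a point outside B and outside both null sets. *)
have escape (A B : set T) : measurable A -> measurable B -> (P B < P A)%E ->
    exists2 w, A w & [/\ ~ Z1 w, ~ Z2 w & ~ B w].
  move=> mA mB BA; apply: contrapT => none.
  have : A `<=` (Z1 `|` Z2) `|` B.
    move=> w Aw; apply: contrapT => nw; apply: none; exists w => //.
    by split=> h; apply: nw; [left; left|left; right|right].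
  have mZ : measurable (Z1 `|` Z2) by exact: measurableU.
  move=> /(le_measure P); rewrite !inE => /(_ mA (measurableU _ _ mZ mB)).
  rewrite leNgt => /negP; apply; apply: le_lt_trans BA.
  apply: le_trans (measureU2 _ mZ mB) _; rewrite -[leRHS]add0e leeD2r //.
  apply: le_trans (measureU2 _ mZ1 mZ2) _.
  by rewrite [X in (X + _)%E]PZ1 [X in (_ + X)%E]PZ2 adde0.
have c_ge : 9/10 <= c.
  have mA : measurable (eta (g 0) @^-1` `[9/10, 1[%classic).
    by rewrite -[X in measurable X]setTI; apply: measurable_funP.
  have [] := escape _ set0 mA measurable0.
    by rewrite measure0 uniform01_itv ?lte_fin //; lra.
  move=> w Aw [n1 n2 _]; have [<- w01] := good w n1 n2.
  apply: le_trans (@kappa_ge _ _ _ (g 0) (le01 _ w01) [::] isT).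
  by move: Aw; rewrite /= in_itv /= => /andP[].
have rho01 := mgf_bound_lt1 R; set rho := mgf_bound R in rho01.
have rho1 : 0 < 1 - rho by lra.
(* The factor 4 counts the bad sets: upper and lower deviations on either side. *)
have [M small] : exists M, (20/21 : R) ^+ M * 4 < 1 - rho.
  have q1 : `|20/21 : R| < 1 by rewrite gtr0_norm; lra.
  have e0 : 0 < (1 - rho) / 4 by rewrite divr_gt0.
  have /cvgrPdist_lt/(_ _ e0)[M _ /(_ M (leqnn M)) MP] := cvg_expr q1.
  exists M; rewrite -ltr_pdivlMr //; apply: le_lt_trans MP.
  by rewrite sub0r normrN ler_norm.
pose rt (i : nat) := g (i%:Z + 1); pose lt_ (i : nat) := g (- i%:Z).
have rt_inj : injective rt by move=> i j /(can_inj gK); lia.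
have lt_inj : injective lt_ by move=> i j /(can_inj gK); lia.
(* The 2M nearest vertices on either side; the vertex 0 itself belongs to the left half. *)
pose J : {fset G} := [fset x in map rt (iota 0 M.*2) ++ map lt_ (iota 0 M.*2)]%fset.
have JE x : (x \in J) = (x \in map rt (iota 0 M.*2)) || (x \in map lt_ (iota 0 M.*2)).
  by rewrite in_fset mem_cat.
have rtJ i : (rt i \in J) = (i < M.*2)%N.
  rewrite JE mem_map // mem_iota /= add0n orbC; case: mapP => // -[j _].
  by move=> /(can_inj gK); lia.
have ltJ i : (lt_ i \in J) = (i < M.*2)%N.
  rewrite JE (mem_map lt_inj) mem_iota /= add0n; case: mapP => // -[j _].
  by move=> /(can_inj gK); lia.
have cover phi mirror := @deviation_cover phi mirror J M.
have rtJ1 i : (i < M.*2)%N -> rt i \in J by rewrite rtJ.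
have ltJ1 i : (i < M.*2)%N -> lt_ i \in J by rewrite ltJ.
have rtJ2 i : (M.*2 <= i)%N -> rt i \notin J by rewrite rtJ -leqNgt.
have ltJ2 i : (M.*2 <= i)%N -> lt_ i \notin J by rewrite ltJ -leqNgt.
have [B1 [mB1 B1P PB1]] := cover _ false rt_inj rtJ1 rtJ2.
have [B2 [mB2 B2P PB2]] := cover _ true rt_inj rtJ1 rtJ2.
have [B3 [mB3 B3P PB3]] := cover _ false lt_inj ltJ1 ltJ2.
have [B4 [mB4 B4P PB4]] := cover _ true lt_inj ltJ1 ltJ2.
have mwin i : i \in J -> measurable (@window R) by move=> _; exact: measurable_itv.
have mA := bigcap_fset_measurable eta (W := fun=> @window R) mwin.
have PA : P (\bigcap_(i in [set` J]) (eta i @^-1` @window R)) = (10^-1 ^+ #|` J|)%:E.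
  by rewrite (eta_indep J (fun=> @window R) mwin) window_prob.
have mB : measurable ((B1 `|` B2) `|` (B3 `|` B4)) by do 3 ?apply: measurableU.
have [] := escape _ _ mA mB.
  rewrite PA; apply: le_lt_trans (measureU2 _ _ _) _; [exact: measurableU..|].
  apply: le_lt_trans (leeD (measureU2 _ mB1 mB2) (measureU2 _ mB3 mB4)) _.
  apply: le_lt_trans (leeD (leeD PB1 PB2) (leeD PB3 PB4)) _.
  rewrite -!EFinD lte_fin -/rho; set r := 10^-1 ^+ _.
  have r0 : 0 < r by rewrite exprn_gt0 // invr_gt0.
  rewrite -!mulrDl ltr_pdivrMr //.
  by nra.
move=> w Aw [n1 n2 nB]; have [kc w01] := good w n1 n2.
have win i : i \in J -> window (eta i w) by exact: Aw.
have : kappa (fun u => eta u w) (g 0) <= 4/5.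
  apply: kappa_le => //; first exact: le01.
  apply: (line_level_le fK gK gadj).
  - apply: (@window_cone _ (fun i => eta (rt i) w) M.*2).
    + by move=> i /rtJ1; exact: win.
    + by apply: B1P => // h; apply: nB; left; left.
    + by apply: B2P => // h; apply: nB; left; right.
  - apply: (@window_cone _ (fun i => eta (lt_ i) w) M.*2).
    + by move=> i /ltJ1; exact: win.
    + by apply: B3P => // h; apply: nB; right; left.
    + by apply: B4P => // h; apply: nB; right; right.
by rewrite kc; lra.
Qed.

End LineKappa.

Theorem corollary3p2 (R : realType) (G : sgraph)
    (Ginf : infinite_set [set: G]) (Gconn : connected_graph G)
    (Gqt : quasi_transitive G) (Gdeg : bounded_degree G)
    (d : measure_display) (T : measurableType d) (P : probability T R)
    (eta : G -> {RV P >-> R}) (eta_iid : iid_uniform01 eta) (v : G) :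
  ~ deterministic P (fun w : T => kappa (fun u : G => eta u w) v) <->
  isomorphic G int_path.
Proof.
split.
  move=> nondet; apply: contrapT => nZ; apply: nondet.
  have Gfin x : finite_set [set w : G | adj x w].
    by have [D DP] := Gdeg; apply/finite_set_leP; exists D.
  have [z nz] : exists z : G, ~ deg2 z.
    by apply/existsNP => all2; apply: nZ; exact: deg2_int_path.
  have [p [N [ext [L [pNext p0 N_le]]]]] := comb_exists v Gconn Gqt Gfin Ginf nz.
  exists 1; rewrite -p0.
  exact: (comb_kappa_eq1 eta_iid pNext N_le (graph_countable Gconn Gfin v)).
move=> [f [[g gK fK] f_adj]].
(* Recentring the isomorphism puts [v] at 0. *)
pose h (i : int) := g (i + f v).
have -> : v = h 0 by rewrite /h add0r gK.
apply: (@line_not_deterministic _ _ _ _ _ _ eta_iid h (fun x => f x - f v)).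
- by move=> x; rewrite /h subrK gK.
- by move=> i; rewrite /h fK addrK.
- move=> i j; rewrite /h -f_adj !fK /adj /= /int_adj.
  by congr (_ || _); apply/eqP/eqP; lia.
Qed.
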